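(* Let $V_1,\dots,V_d,W_1,\dots,W_d$ be finite-dimensional $\mathbb{C}$-vector spaces, $v\in V_1\otimes\cdots\otimes V_d$, $w\in W_1\otimes\cdots\otimes W_d$, and $\alpha,\beta\in\mathbb{R}^d_{>0}$. Then $$\operatorname{rk}^G_{\alpha\beta}(v\boxtimes w)\ge\operatorname{rk}^G_\alpha(v)\,\operatorname{rk}^G_\beta(w),$$ where $\alpha\beta=(\alpha_1\beta_1,\dots,\alpha_d\beta_d)$.
   Context: Vertical tensor product: $v\boxtimes w$ denotes $v\otimes w$ viewed as an element of $(V_1\otimes W_1)\otimes\cdots\otimes(V_d\otimes W_d)$, a tensor with $d$ factors. $G$-stable rank over $K=\mathbb{C}$ of a tensor $u\in U=U_1\otimes\cdots\otimes U_d$ ($U_i$ finite-dimensional over $K$) with weight $\gamma\in\mathbb{R}^d_{>0}$: for a $K$-vector space $W$ and $v(t)\in K((t))\otimes W$, $\operatorname{val}_t(v(t))$ is the largest integer $m$ with $v(t)\in t^m(K[[t]]\otimes W)$, and $\operatorname{val}_t(0)=\infty$. Let $\mathrm{GL}(U_i,K[[t]])$ be the set of elements of $K[[t]]\otimes\operatorname{End}(U_i)$ that are invertible over $K((t))$ (the inverse need not have entries in $K[[t]]$), and $G(K[[t]])=\prod_i\mathrm{GL}(U_i,K[[t]])$, acting on $K((t))\otimes U$ factorwise. Then $\operatorname{rk}^G_\gamma(u)$ is the infimum of $$\mu_\gamma(g(t),u)=\frac{\sum_{i=1}^d\gamma_i\operatorname{val}_t(\det g_i(t))}{\operatorname{val}_t(g(t)\cdot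 u)}$$ over all $g(t)=(g_1(t),\dots,g_d(t))\in G(K[[t]])$ with $\operatorname{val}_t(g(t)\cdot u)>0$ (a quotient with denominator $\infty$ is $0$). *)

(* Defs.v *)
From HB Require Import structures.
From mathcomp Require Import all_boot all_order all_algebra.
From mathcomp Require Import complex.
From mathcomp Require Import all_classical all_reals.
From mathcomp Require Import ereal.

Set Implicit Arguments.
Unset Strict Implicit.
Unset Printing Implicit Defensive.

Import Order.TTheory GRing.Theory Num.Theory.

Local Open Scope ring_scope.

(* K[[t]]: the series \sum_n f(n) t^n is the function f.  Only the additive  *)
(* structure is the pointwise one.                                           *)
Definition fps (K : fieldType) : Type := nat -> K.

Section PowerSeries.
Variable K : fieldType.
Implicit Types f g h : fps K.

HB.instance Definition _ := GRing.Zmodule.copy (fps K) (nat -> K).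

Definition fps_mul f g : fps K := fun n => \sum_(i < n.+1) f i * g (n - i)%N.
Definition fps_one : fps K := fun n => (n == 0%N)%:R.

Lemma fps_mul_trunc N f g n : (n < N)%N ->
  fps_mul f g n = ((\poly_(i < N) f i) * (\poly_(i < N) g i))`_n.
Proof.
move=> ltnN; rewrite coefM; apply: eq_bigr => i _.
rewrite !coef_poly (leq_ltn_trans (leq_subr _ _) ltnN).
by rewrite (leq_trans (ltn_ord i) ltnN).
Qed.

Lemma fps_mulC : commutative fps_mul.
Proof.
by move=> f g; apply/funext => n; rewrite !(@fps_mul_trunc n.+1)// mulrC.
Qed.

Lemma fps_mulA : associative fps_mul.
Proof.
have H f g h n : fps_mul f (fps_mul g h) n =
    ((\poly_(i < n.+1) f i) *
     ((\poly_(i < n.+1) g i) * (\poly_(i < n.+1) h i)))`_n.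
  rewrite coefM /fps_mul; apply: eq_bigr => i _; rewrite coef_poly ltn_ord.
  by rewrite -fps_mul_trunc // ltnS leq_subr.
move=> f g h; apply/funext => n.
by rewrite H [RHS](congr1 (@^~ n) (fps_mulC _ _)) H mulrA [in RHS]mulrC.
Qed.

Lemma fps_mul1 : left_id fps_one fps_mul.
Proof.
move=> f; apply/funext => n; rewrite /fps_mul big_ord_recl subn0 mul1r big1 ?addr0//.
by move=> i _; rewrite /fps_one /= mul0r.
Qed.

Lemma fps_mulDl : left_distributive fps_mul +%R.
Proof.
move=> f g h; apply/funext => n.
transitivity (fps_mul f h n + fps_mul g h n); last by [].
rewrite /fps_mul -big_split /=.
by apply: eq_bigr => i _; rewrite -mulrDl.
Qed.

Lemma fps_oneN0 : fps_one != 0 :> fps K.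
Proof. by apply/eqP => /(congr1 (@^~ 0%N)) /eqP; rewrite /= oner_eq0. Qed.

HB.instance Definition _ := GRing.Zmodule_isComNzRing.Build (fps K)
  fps_mulA fps_mulC fps_mul1 fps_mulDl fps_oneN0.

Definition fps_unit : pred (fps K) := fun f => `[< exists g, g * f = 1 >].
Definition fps_inv f : fps K :=
  if pselect (exists g, g * f = 1) is left e then projT1 (cid e) else f.

Lemma fps_mulV : {in fps_unit, left_inverse 1 fps_inv *%R}.
Proof.
move=> f /asboolP ex; rewrite /fps_inv; case: pselect => // e.
by case: (cid e).
Qed.

Lemma fps_unitP f g : g * f = 1 -> fps_unit f.
Proof. by move=> gf; apply/asboolP; exists g. Qed.

Lemma fps_inv_out : {in [predC fps_unit], fps_inv =1 id}.
Proof.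
move=> f /asboolPn nex; rewrite /fps_inv; case: pselect => // e.
Qed.

HB.instance Definition _ := GRing.ComNzRing_hasMulInverse.Build (fps K)
  fps_mulV fps_unitP fps_inv_out.

Lemma fps_idomain f g : f * g = 0 -> (f == 0) || (g == 0).
Proof.
move=> fg0; apply/norP => -[f0 g0].
have ex (h : fps K) : h != 0 -> exists n, h n != 0.
  move=> h0; apply: contrapT => /forallNP H; case/eqP: h0.
  by apply/funext => n; apply/eqP/negPn/negP/H.
have [a fa amin] := ex_minnP (ex f f0).
have [b gb bmin] := ex_minnP (ex g g0).
have : fps_mul f g (a + b)%N = 0 by rewrite [LHS](congr1 (@^~ _) fg0).
have lta : (a < (a + b).+1)%N by rewrite ltnS leq_addr.
rewrite /fps_mul (bigD1 (Ordinal lta)) //= addKn big1 => [|i].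
  by apply/eqP; rewrite addr0 mulf_neq0.
rewrite -val_eqE /= neq_ltn => /orP[ia|ai].
  have [->|/amin] := eqVneq (f i) 0; first by rewrite mul0r.
  by rewrite leqNgt ia.
have [->|/bmin] := eqVneq (g (a + b - i)%N) 0; first by rewrite mulr0.
by rewrite leqNgt ltn_subLR ?ltn_add2r ?ai // -ltnS.
Qed.

HB.instance Definition _ :=
  GRing.ComUnitRing_isIntegral.Build (fps K) fps_idomain.

Definition fps_const (c : K) : fps K := fun n => if n == 0%N then c else 0.
Definition fps_t : fps K := fun n => (n == 1%N)%:R.

End PowerSeries.

Notation laurent K := {fraction (fps K)}.

Notation mindex U := {dffun forall i, 'I_(\dim {:U i})}.

Local Notation "x %:F" := (FracField.tofrac x).

Section Rank.
Variables (K : fieldType) (R : realType).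

(* A vector of K((t)) \otimes W is given by its coordinates v : I -> K((t)).  *)
(* This is the largest m with v \in t^m (K[[t]] \otimes W), and +oo for v = 0. *)
Definition valt (I : Type) (v : I -> laurent K) : \bar R :=
  ereal_sup [set (m%:~R)%:E | m in
    [set m : int | exists f : I -> fps K,
       forall i, v i = (fps_t K)%:F ^ m * (f i)%:F]]%classic.

(* GL(U, K[[t]]) for dim U = n: the inverse only has to exist over K((t)).   *)
Definition GLt n : set 'M[laurent K]_n :=
  [set g | (exists h : 'M[fps K]_n, g = map_mx (fun f => f%:F) h)
           /\ g \in unitmx]%classic.

Variable d : nat.
Implicit Types U V W : 'I_d -> vectType K.

(* A \otimes U_1 \otimes ... \otimes U_d, in coordinates with respect to the   *)
(* tensors of vectors of the bases (vbasis {:U i}); tpure gives x_1 \otimes    *)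
(* ... \otimes x_d.                                                           *)
Definition tensor_over (A : Type) U : Type := {ffun mindex U -> A}.

Definition tensor U := tensor_over K U.

Definition tpure U (x : forall i, U i) : tensor U :=
  [ffun k : mindex U => \prod_i coord (vbasis {:U i}) (k i) (x i)].

Definition tconst U (u : tensor U) : tensor_over (laurent K) U :=
  [ffun k : mindex U => (fps_const (u k))%:F].

(* g i is the matrix, acting on columns, of an endomorphism in the basis     *)
(* (vbasis {:U i}).                                                          *)
Definition tact U (g : forall i, 'M[laurent K]_(\dim {:U i}))
    (u : tensor_over (laurent K) U) : tensor_over (laurent K) U :=
  [ffun k : mindex U => \sum_(l : mindex U) (\prod_i g i (k i) (l i)) * u l].

(* In \bar R, (+oo)^-1 = 0.                                                  *)
Definition mu U (gamma : 'I_d -> R) (g : forall i, 'M[laurent K]_(\dim {:U i}))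
    (u : tensor U) : \bar R :=
  ((\sum_i (gamma i)%:E * valt (fun _ : unit => \det (g i)))
     / valt (tact g (tconst u)))%E.

Definition gstable_rank U (gamma : 'I_d -> R) (u : tensor U) : \bar R :=
  ereal_inf [set mu gamma g u | g in
    [set g : forall i, 'M[laurent K]_(\dim {:U i}) |
       (forall i, GLt (g i)) /\ (0 < valt (tact g (tconst u)))%E]]%classic.

(* V \otimes W, again in coordinates with respect to the chosen bases.        *)
Definition tens2 (V W : vectType K) : vectType K :=
  'M[K]_(\dim {:V}, \dim {:W}).

Definition tpure2 (V W : vectType K) (x : V) (y : W) : tens2 V W :=
  \matrix_(a, b) (coord (vbasis {:V}) a x * coord (vbasis {:W}) b y).

Definition vtens V W (v : tensor V) (w : tensor W) :
    tensor (fun i => tens2 (V i) (W i)) :=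
  [ffun m : mindex (fun i => tens2 (V i) (W i)) =>
     \sum_(k : mindex V) \sum_(l : mindex W) v k * w l *
       tpure (fun i => tpure2 (vbasis {:V i})`_(k i) (vbasis {:W i})`_(l i)) m].

Lemma sum_mindex_prod U (P : forall i, 'I_(\dim {:U i}) -> K) :
  \sum_(k : mindex U) \prod_i P i (k i) = \prod_i \sum_a P i a.
Proof.
pose Q i := [ffun a => P i a].
transitivity (\prod_i \sum_a Q i a); last first.
  by apply: eq_bigr => i _; apply: eq_bigr => a _; rewrite ffunE.
under [RHS]eq_bigr do rewrite (big_tag (fun i => Q i)).
rewrite bigA_distr_big_dep -big_fprod.
rewrite (reindex (@fprod_of_dffun _ _)) /=; last first.
  exact/onW_bij/fprod_of_dffun_bij.
apply: eq_bigr => k _; apply: eq_bigr => i _.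
by rewrite ffunE -[in LHS](fprod_of_dffunK k) ffunE.
Qed.

(* vtens is the bilinear extension of                                        *)
(* (\otimes_i x_i, \otimes_i y_i) |-> \otimes_i (x_i \otimes y_i).           *)
Lemma vtens_tpure V W (x : forall i, V i) (y : forall i, W i) :
  vtens (tpure x) (tpure y) = tpure (fun i => tpure2 (x i) (y i)).
Proof.
apply/ffunP => m; rewrite !ffunE.
have E i : tpure2 (x i) (y i) =
    \sum_a \sum_b (coord (vbasis {:V i}) a (x i) * coord (vbasis {:W i}) b (y i))
       *: tpure2 (vbasis {:V i})`_a (vbasis {:W i})`_b.
  have freeb (T : vectType K) : free (vbasis {:T}) by exact/basis_free/vbasisP.
  apply/matrixP => a b; rewrite summxE (bigD1 a)//= summxE (bigD1 b)//= !mxE.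
  rewrite !coord_free ?freeb// !eqxx !mulr1 big1 ?addr0 => [|b' nb]; last first.
    by rewrite !mxE !coord_free ?freeb// (negbTE nb) !mulr0.
  rewrite big1 ?addr0// => a' na; rewrite summxE big1// => b' _.
  by rewrite !mxE !coord_free ?freeb// (negbTE na) mul0r mulr0.
under [RHS]eq_bigr => i _.
  rewrite E linear_sum /=; under eq_bigr do rewrite linear_sum /=.
  over.
rewrite -(@sum_mindex_prod V); apply: eq_bigr => k _.
rewrite -(@sum_mindex_prod W); apply: eq_bigr => l _.
rewrite !ffunE -!big_split /=.
by apply: eq_bigr => i _; rewrite linearZ.
Qed.

End Rank.

(* Main.v *)
From HB Require Import structures.
Require Import Defs.
From mathcomp Require Import all_boot all_order all_algebra.
From mathcomp Require Import perm complex ring lra.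
From mathcomp Require Import all_classical all_reals.
From mathcomp Require Import ereal topology normedtype derive sequences exp.

(** Both sides of the inequality are described by linear inequalities for
one-parameter subgroups.  Over K[[t]] a matrix of nonzero determinant is
a(t) * diag(t^lambda) * b(t) with a and b invertible; a(t) changes no
valuation, and if t^lambda b(t) u is divisible by t^m then the coordinates
of b(0) u on which lambda has weight less than m vanish.  So only constant
changes of basis b and diagonal t^lambda matter, and for r > 0 the rank of u
is at least r exactly when r m <= sum_i gamma_i |lambda_i| whenever all
nonzero coordinates of b u have lambda-weight at least m
([one_param_bound_of_rank], [rank_of_one_param_bound]; any field).

Over the complex numbers this is turned into a metric condition, in the manner
of Kempf and Ness.  Let F(g) = |g v|^2 / prod_i |det g_i|^(2 c_i) with
c_i = alpha_i / r, for tuples g of matrices of Frobenius norm at most 1.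

- If v satisfies the one-parameter bound, F is bounded below by a positive
  constant ([capacity_gt0]).  Writing g_i^* g_i = u_i^* D_i u_i with u_i
  unitary, |g v|^2 is the sum of the |(u v)_k|^2 weighted by products of
  entries of D; the bound compares this weighted sum with prod_i (det D_i)^c_i,
  uniformly in u because the unitary matrices form a compact set.

- An almost minimizer g of F makes w = g v almost balanced: shrinking w
  slightly in factor i along a unit vector x decreases |w|^2 by at most about
  as much as it decreases the determinant factor, so the slice of w along x
  carries at most about c_i |w|^2 ([exists_balanced]).  The constraint on the
  norm of g causes no difficulty, since contractions preserve it.

- Conversely, for a balanced w Jensen's inequality bounds F from below
  ([balanced_capacity]), and evaluating this bound at diag(q^lambda) b for
  q tending to 0 gives back the one-parameter bound
  ([one_param_bound_of_balanced]).

Balanced tensors multiply: slicing a Kronecker product along a matrix amounts to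
slicing the first tensor, and then the second one along the resulting vectors,
so the constants c_i are multiplied ([balanced_kron]).  Together with the
equivalences above this shows that the one-parameter bounds with constants r
and s for v and w imply the one with constant r s for the vertical product. *)

Set Implicit Arguments.
Unset Strict Implicit.
Unset Printing Implicit Defensive.
Import Order.TTheory GRing.Theory Num.Theory.
Import numFieldNormedType.Exports.
Local Open Scope ring_scope.
Local Open Scope sesquilinear_scope.
Local Notation "x %:C" := (real_complex _ x) (format "x %:C").
Local Notation "x %:F" := (FracField.tofrac x).
Local Notation multi_index n := {dffun forall i, 'I_(n i)}.

(** * Tensors in coordinates *)

Section TensorAction.
Variables (A : comNzRingType) (d : nat).
Implicit Types m n p : 'I_d -> nat.

Lemma sum_multi_index_prod n (P : forall i, 'I_(n i) -> A) :
  \sum_(k : multi_index n) \prod_i P i (k i) = \prod_i \sum_a P i a.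
Proof.
pose Q i := [ffun a => P i a].
transitivity (\prod_i \sum_a Q i a); last first.
  by apply: eq_bigr => i _; apply: eq_bigr => a _; rewrite ffunE.
under [RHS]eq_bigr do rewrite (big_tag (fun i => Q i)).
rewrite bigA_distr_big_dep -big_fprod.
rewrite (reindex (@fprod_of_dffun _ _)) /=; last first.
  exact/onW_bij/fprod_of_dffun_bij.
apply: eq_bigr => k _; apply: eq_bigr => i _.
by rewrite ffunE -[in LHS](fprod_of_dffunK k) ffunE.
Qed.

Definition act m n (g : forall i, 'M[A]_(m i, n i)) (v : multi_index n -> A) :
    multi_index m -> A :=
  fun k => \sum_(l : multi_index n) (\prod_i g i (k i) (l i)) * v l.

Lemma eq_act m n (g h : forall i, 'M[A]_(m i, n i)) v :
  (forall i, g i = h i) -> act g v = act h v.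
Proof. by move=> gh; have -> : g = h by exact/functional_extensionality_dep. Qed.

Lemma act_comp m n p (g : forall i, 'M[A]_(m i, n i))
    (h : forall i, 'M[A]_(n i, p i)) v :
  act g (act h v) = act (fun i => g i *m h i) v.
Proof.
apply/funext => k; rewrite /act.
under eq_bigr do rewrite mulr_sumr.
rewrite exchange_big /=; apply: eq_bigr => l _.
under eq_bigr do rewrite mulrA -big_split /=.
rewrite -mulr_suml; congr (_ * _).
rewrite (sum_multi_index_prod (fun i a => g i (k i) a * h i a (l i))).
by apply: eq_bigr => i _; rewrite mxE.
Qed.

Lemma act_diag n (c : forall i, 'rV[A]_(n i)) v k :
  act (fun i => diag_mx (c i)) v k = (\prod_i c i 0 (k i)) * v k.
Proof.
rewrite /act (bigD1 k) //= [X in _ + X]big1 ?addr0 => [|l lk].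
  by congr (_ * _); apply: eq_bigr => i _; rewrite mxE eqxx mulr1n.
have /existsP[i ki] : [exists i, k i != l i].
  rewrite -negb_forall; apply: contraNN lk => /forallP H.
  by apply/eqP/ffunP => i; rewrite (eqP (H i)).
by rewrite (bigD1 i) //= mxE (negbTE ki) !mul0r.
Qed.

Lemma act1 n (v : multi_index n -> A) : act (fun i => 1%:M) v = v.
Proof.
apply/funext => k; transitivity (act (fun i => diag_mx (const_mx 1)) v k).
  by congr (act _ v k); apply/functional_extensionality_dep => i; rewrite diag_const_mx.
by rewrite act_diag big1 ?mul1r// => i _; rewrite mxE.
Qed.

Lemma actZ m n (g : forall i, 'M[A]_(m i, n i)) c v :
  act (fun i => c i *: g i) v = fun k => (\prod_i c i) * act g v k.
Proof.
apply/funext => k; rewrite /act mulr_sumr; apply: eq_bigr => l _.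
by rewrite mulrA -big_split; congr (_ * _); apply: eq_bigr => i _; rewrite mxE.
Qed.

Lemma act_scale m n (g : forall i, 'M[A]_(m i, n i)) c v k :
  act g (fun l => c * v l) k = c * act g v k.
Proof. by rewrite /act mulr_sumr; apply: eq_bigr => l _; rewrite mulrCA. Qed.

(** Action on a single tensor factor, as a family so that [act] applies. *)
Definition at_pos n i (P : 'M[A]_(n i)) : forall j, 'M[A]_(n j) :=
  @eqtype.dfwith _ (fun j => 'M[A]_(n j)) (fun j => 1%:M) i P.

Lemma at_posE n i (P : 'M[A]_(n i)) : at_pos P i = P.
Proof. by rewrite /at_pos eqtype.dfwith_in. Qed.

Lemma at_pos_neq n i j (P : 'M[A]_(n i)) : i != j -> at_pos P j = 1%:M.
Proof. by move=> ij; rewrite /at_pos eqtype.dfwith_out. Qed.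

Lemma at_posP n i (P : 'M[A]_(n i)) (F : forall j, 'M[A]_(n j)) :
  F i = P -> (forall j, i != j -> F j = 1%:M) -> F = at_pos P.
Proof.
move=> Fi Fj; apply/functional_extensionality_dep => j.
have [<-|ij] := eqVneq i j; first by rewrite at_posE.
by rewrite at_pos_neq ?Fj.
Qed.

Lemma at_pos1 n i : (fun j => 1%:M) = at_pos (1%:M : 'M[A]_(n i)).
Proof. exact: at_posP. Qed.

Definition subst_idx n (k : multi_index n) i (a : 'I_(n i)) : multi_index n :=
  [ffun j => @eqtype.dfwith _ (fun j => 'I_(n j)) (fun j => k j) i a j].

Lemma subst_idx_same n (k : multi_index n) i a : @subst_idx n k i a i = a.
Proof. by rewrite ffunE eqtype.dfwith_in. Qed.

Lemma subst_idx_neq n (k : multi_index n) i a j : i != j -> @subst_idx n k i a j = k j.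
Proof. by move=> ij; rewrite ffunE eqtype.dfwith_out. Qed.

(** In all factors but the [i]-th the identity forces the summation index to agree
with [k], so only the [i]-th index is summed. *)
Lemma act_at_pos n i (P : 'M[A]_(n i)) v k :
  act (at_pos P) v k = \sum_a P (k i) a * v (subst_idx k a).
Proof.
rewrite /act (partition_big (fun l : multi_index n => l i) xpredT) //=.
apply: eq_bigr => a _; rewrite (bigD1 (subst_idx k a)) /=; last by rewrite subst_idx_same.
rewrite [X in _ + X]big1 ?addr0 => [|l /andP[/eqP la lk]].
  congr (_ * _); rewrite (bigD1 i) //= at_posE subst_idx_same big1 ?mulr1 // => j ij.
  by rewrite eq_sym in ij; rewrite at_pos_neq // subst_idx_neq // mxE eqxx.
have /existsP[j kj] : [exists j, (i != j) && (k j != l j)].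
  apply: contraNT lk => /existsPn H; apply/eqP/ffunP => j.
  have [<-|ij] := eqVneq i j; first by rewrite subst_idx_same.
  by rewrite subst_idx_neq //; have := H j; rewrite ij negbK => /eqP.
case/andP: kj => ij kj.
by rewrite (bigD1 j) //= at_pos_neq // mxE (negbTE kj) !mul0r.
Qed.

Lemma act_at_posDZ n i (c : A) (P Q : 'M[A]_(n i)) v k :
  act (at_pos (P + c *: Q)) v k = act (at_pos P) v k + c * act (at_pos Q) v k.
Proof.
rewrite !act_at_pos mulr_sumr -big_split /=; apply: eq_bigr => a _.
by rewrite !mxE mulrDl mulrA.
Qed.

Lemma act_at_posZ n i (c : A) (Q : 'M[A]_(n i)) v k :
  act (at_pos (c *: Q)) v k = c * act (at_pos Q) v k.
Proof.
rewrite !act_at_pos mulr_sumr; apply: eq_bigr => a _.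
by rewrite !mxE mulrA.
Qed.

End TensorAction.

Lemma map_act (A B : comNzRingType) (f : {rmorphism A -> B}) d
    (m n : 'I_d -> nat) (g : forall i, 'M[A]_(m i, n i)) (v : multi_index n -> A) k :
  f (act g v k) = act (fun i => map_mx f (g i)) (fun l => f (v l)) k.
Proof.
rewrite /act rmorph_sum; apply: eq_bigr => l _.
by rewrite rmorphM rmorph_prod; congr (_ * _); apply: eq_bigr => i _; rewrite mxE.
Qed.

(** * Hermitian geometry of tensors *)

Section Hermitian.
Variable R : realType.
Local Notation C := R[i].

Definition nsq (z : C) : R := complex.Re z ^+ 2 + complex.Im z ^+ 2.

Lemma nsqE z : (nsq z)%:C = z^* * z.
Proof. by rewrite /nsq add_Re2_Im2 mulrC normCK. Qed.

Lemma nsq_ge0 z : 0 <= nsq z.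
Proof. by rewrite addr_ge0 ?sqr_ge0. Qed.

Lemma nsq_eq0 z : (nsq z == 0) = (z == 0).
Proof.
by rewrite -(inj_eq (@complexI R)) nsqE mulrC -normCK sqrf_eq0 normr_eq0.
Qed.

Lemma nsq_gt0 z : (0 < nsq z) = (z != 0).
Proof. by rewrite lt_def nsq_ge0 andbT nsq_eq0. Qed.

Lemma nsqM z1 z2 : nsq (z1 * z2) = nsq z1 * nsq z2.
Proof. by apply: (@complexI R); rewrite rmorphM /= !nsqE rmorphM mulrACA. Qed.

Lemma nsq1 : nsq 1 = 1.
Proof. by apply: (@complexI R); rewrite nsqE rmorph1 mulr1. Qed.

Lemma nsq0 : nsq 0 = 0.
Proof. by apply/eqP; rewrite nsq_eq0. Qed.

Lemma nsq_real (x : R) : nsq x%:C = x ^+ 2.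
Proof. by rewrite /nsq /= expr0n addr0. Qed.

Definition fnorm m n (M : 'M[C]_(m, n)) : R := \sum_i \sum_j nsq (M i j).

Lemma fnorm_ge0 m n (M : 'M[C]_(m, n)) : 0 <= fnorm M.
Proof. by rewrite sumr_ge0 // => i _; rewrite sumr_ge0 // => j _; exact: nsq_ge0. Qed.

Lemma fnormE m n (M : 'M[C]_(m, n)) : (fnorm M)%:C = \tr (M^t* *m M).
Proof.
rewrite /fnorm exchange_big rmorph_sum /=; apply: eq_bigr => j _.
rewrite mxE rmorph_sum; apply: eq_bigr => i _.
by rewrite /= nsqE !mxE.
Qed.

Lemma fnorm_rowE n (x : 'rV[C]_n) : (fnorm x)%:C = (x *m x^t*) 0 0.
Proof.
rewrite /fnorm big_ord1 mxE rmorph_sum; apply: eq_bigr => j _.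
by rewrite /= nsqE !mxE mulrC.
Qed.

Lemma fnormZ m n c (M : 'M[C]_(m, n)) : fnorm (c *: M) = nsq c * fnorm M.
Proof.
rewrite /fnorm mulr_sumr; apply: eq_bigr => i _; rewrite mulr_sumr.
by apply: eq_bigr => j _; rewrite mxE nsqM.
Qed.

Lemma nsq_le_fnorm m n (M : 'M[C]_(m, n)) i j : nsq (M i j) <= fnorm M.
Proof.
rewrite /fnorm (bigD1 i) //= (bigD1 j) //= -addrA lerDl addr_ge0 // sumr_ge0 // => k _.
  exact: nsq_ge0.
by rewrite sumr_ge0 // => l _; exact: nsq_ge0.
Qed.

Lemma fnorm_eq0 m n (M : 'M[C]_(m, n)) : fnorm M = 0 -> M = 0.
Proof.
move=> M0; apply/matrixP => i j; apply/eqP; rewrite mxE -nsq_eq0 eq_le nsq_ge0.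
by rewrite -M0 nsq_le_fnorm.
Qed.

Lemma fnorm_row_unitary n (u : 'M[C]_n) j : u \is unitarymx -> fnorm (row j u) = 1.
Proof.
move=> uu; apply: (@complexI R); rewrite fnorm_rowE rmorph1 tr_row map_col !mxE.
have /unitarymxP/matrixP/(_ j j) := uu; rewrite !mxE eqxx mulr1n => <-.
by apply: eq_bigr => a _; rewrite !mxE.
Qed.

Variable d : nat.
Implicit Types n p : 'I_d -> nat.

Definition dot n (v w : multi_index n -> C) : C := \sum_(k : multi_index n) (v k)^* * w k.

Definition nrm n (v : multi_index n -> C) : R := \sum_(k : multi_index n) nsq (v k).

Lemma nrmE n (v : multi_index n -> C) : (nrm v)%:C = dot v v.
Proof. by rewrite /nrm rmorph_sum; apply: eq_bigr => k _; rewrite /= nsqE. Qed.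

Lemma nrm_ge0 n (v : multi_index n -> C) : 0 <= nrm v.
Proof. by rewrite sumr_ge0 // => k _; exact: nsq_ge0. Qed.

Lemma nsq_le_nrm n (v : multi_index n -> C) k : nsq (v k) <= nrm v.
Proof. by rewrite /nrm (bigD1 k) //= lerDl sumr_ge0 // => l _; exact: nsq_ge0. Qed.

Lemma dot_act m n (g : forall i, 'M[C]_(m i, n i)) v w :
  dot (act g v) w = dot v (act (fun i => (g i)^t*) w).
Proof.
rewrite /dot /act; under eq_bigr do rewrite rmorph_sum mulr_suml.
rewrite exchange_big /=; apply: eq_bigr => l _; rewrite mulr_sumr.
apply: eq_bigr => k _; rewrite rmorphM rmorph_prod mulrAC mulrC; congr (_ * (_ * _)).
by apply: eq_bigr => i _; rewrite !mxE.
Qed.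

Lemma nrm_act n m (g : forall i, 'M[C]_(m i, n i)) v :
  (nrm (act g v))%:C = dot v (act (fun i => (g i)^t* *m g i) v).
Proof. by rewrite nrmE dot_act act_comp. Qed.

Lemma nrm_act_diag n m (g : forall i, 'M[C]_(m i, n i))
    (c : forall i, 'I_(n i) -> R) v :
  (forall i, (g i)^t* *m g i = diag_mx (\row_j (c i j)%:C)) ->
  nrm (act g v) = \sum_(k : multi_index n) (\prod_i c i (k i)) * nsq (v k).
Proof.
move=> gc; apply: (@complexI R); rewrite nrm_act (eq_act v gc).
rewrite /dot rmorph_sum; apply: eq_bigr => k _.
rewrite act_diag /= rmorphM /= nsqE rmorph_prod mulrCA; congr (_ * _).
by apply: eq_bigr => i _; rewrite mxE.
Qed.

Lemma nrm_act_isometry n m (g : forall i, 'M[C]_(m i, n i)) v :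
  (forall i, (g i)^t* *m g i = 1%:M) -> nrm (act g v) = nrm v.
Proof.
by move=> gc; apply: (@complexI R); rewrite nrm_act nrmE (eq_act v gc) act1.
Qed.

(** Squared norm of the contraction of [w] along [x] in factor [i], counted [n i]
times: the [i]-th index of [k] is overwritten but still summed over.  This
redundancy avoids index types with one factor removed. *)
Definition slice_energy n i (x : 'rV[C]_(n i)) (w : multi_index n -> C) : R :=
  \sum_(k : multi_index n) nsq (\sum_a x 0 a * w (subst_idx k a)).

(** Contracting by [x] in every row is the action of the matrix all of whose rows
are [x], and that matrix has Gram matrix [n i] times [x^* x]. *)
Lemma slice_energyE n i (x : 'rV[C]_(n i)) w :
  (slice_energy x w)%:C = (n i)%:R * dot w (act (at_pos (x^t* *m x)) w).
Proof.
pose P := const_mx 1 *m x : 'M[C]_(n i).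
have -> : slice_energy x w = nrm (act (at_pos P) w).
  apply: eq_bigr => k _; rewrite act_at_pos; congr nsq; apply: eq_bigr => a _.
  by rewrite mxE big_ord1 mxE mul1r.
rewrite nrm_act; have -> : (fun j => (at_pos P j)^t* *m at_pos P j) =
    at_pos ((n i)%:R *: (x^t* *m x)).
  apply: at_posP => [|j ij]; last by rewrite at_pos_neq // mulmx1 trmx1 map_mx1.
  rewrite at_posE /P trmx_mul map_mxM mulmxA -[_ *m _ *m const_mx 1]mulmxA.
  have -> : (const_mx 1 : 'cV[C]_(n i))^t* *m (const_mx 1 : 'cV[C]_(n i)) = (n i)%:R%:M.
    apply/matrixP => a b; rewrite !mxE !ord1 /= ?eqxx ?mulr1n.
    under eq_bigr do rewrite !mxE mulr1 rmorph1.
    by rewrite sumr_const card_ord.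
  by rewrite mul_mx_scalar -scalemxAl.
rewrite /dot mulr_sumr; apply: eq_bigr => k _.
by rewrite act_at_posZ mulrCA.
Qed.

Lemma slice_energyZ n i c (x : 'rV[C]_(n i)) w : slice_energy (c *: x) w = nsq c * slice_energy x w.
Proof.
rewrite /slice_energy mulr_sumr; apply: eq_bigr => k _; rewrite -nsqM mulr_sumr.
by congr nsq; apply: eq_bigr => a _; rewrite mxE mulrA.
Qed.

(** The reduced density matrix of [w] in factor [i] is at most [c i * nrm w] in the
Loewner order; the factor [n i] compensates the redundancy of [slice_energy]. *)
Definition balanced n (c : 'I_d -> R) (w : multi_index n -> C) : Prop :=
  forall i (x : 'rV[C]_(n i)),
    slice_energy x w <= (n i)%:R * c i * fnorm x * nrm w.

(** [c] lists the squared singular values: [g^* g] is normal, hence unitarily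
diagonalizable, and its eigenvalues are the squared norms of the columns of
[g u^*]. *)
Lemma singular_values (n : nat) (g : 'M[C]_n) :
  exists (u : 'M[C]_n) (c : 'I_n -> R),
    [/\ u \is unitarymx, forall j, 0 <= c j, \sum_j c j = fnorm g,
        \prod_j c j = nsq (\det g) &
        (g *m u^t*)^t* *m (g *m u^t*) = diag_mx (\row_j (c j)%:C)].
Proof.
have gn : g^t* *m g \is normalmx.
  by apply/normalmxP; rewrite trmx_mul map_mxM trmxCK.
have := orthomx_spectralP gn; have := spectral_unitarymx (g^t* *m g).
set u := spectralmx _; set D := spectral_diag _ => uu.
rewrite invmx_unitary // => gE.
have uU : u *m u^t* = 1%:M by exact/unitarymxP.
have Ug : (g *m u^t*)^t* *m (g *m u^t*) = diag_mx D.
  rewrite trmx_mul map_mxM trmxCK mulmxA -[_ *m _ *m g]mulmxA gE !mulmxA uU mul1mx.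
  by rewrite -mulmxA uU mulmx1.
pose c j := \sum_a nsq ((g *m u^t*) a j).
have Dc : D = \row_j (c j)%:C.
  apply/rowP => j; move/matrixP/(_ j j): Ug; rewrite !mxE eqxx mulr1n => <-.
  rewrite rmorph_sum; apply: eq_bigr => a _.
  by rewrite /= nsqE !mxE.
exists u, c; split => //.
- by move=> j; rewrite sumr_ge0 // => a _; exact: nsq_ge0.
- apply: (@complexI R); rewrite fnormE gE mxtrace_mulC mulmxA uU mul1mx mxtrace_diag.
  by rewrite rmorph_sum Dc; apply: eq_bigr => j _; rewrite mxE.
- apply: (@complexI R); rewrite nsqE.
  have <- : \det (g^t*) = (\det g)^* by rewrite det_map_mx det_tr.
  rewrite -det_mulmx gE.
  rewrite !det_mulmx mulrAC -det_mulmx.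
  have -> : u^t* *m u = 1%:M by apply: mulmx1C.
  by rewrite det1 mul1r det_diag Dc rmorph_prod; apply: eq_bigr => j _; rewrite mxE.
- by rewrite Ug Dc.
Qed.

Lemma simultaneous_singular_values n (g : forall i, 'M[C]_(n i)) :
  exists (u : forall i, 'M[C]_(n i)) (c : forall i, 'I_(n i) -> R),
    forall i, [/\ u i \is unitarymx, forall j, 0 <= c i j,
        \sum_j c i j = fnorm (g i), \prod_j c i j = nsq (\det (g i)) &
        (g i *m (u i)^t*)^t* *m (g i *m (u i)^t*) = diag_mx (\row_j (c i j)%:C)].
Proof.
pose S i := cid (singular_values (g i)).
exists (fun i => sval (S i)), (fun i => sval (cid (svalP (S i)))) => i.
exact: svalP (cid (svalP (S i))).
Qed.

Lemma nrm_act_singular n (g : forall i, 'M[C]_(n i)) (u : forall i, 'M[C]_(n i))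
    (c : forall i, 'I_(n i) -> R) v :
  (forall i, u i \is unitarymx) ->
  (forall i, (g i *m (u i)^t*)^t* *m (g i *m (u i)^t*) =
     diag_mx (\row_j (c i j)%:C)) ->
  nrm (act g v) = \sum_(k : multi_index n) (\prod_i c i (k i)) * nsq (act u v k).
Proof.
move=> uu gc; rewrite -(nrm_act_diag _ gc) act_comp; congr nrm; apply: eq_act => i.
have uU : (u i)^t* *m u i = 1%:M by apply: mulmx1C; exact/unitarymxP.
by rewrite -mulmxA uU mulmx1.
Qed.

Lemma singular_value_bounds (n : nat) (g : 'M[C]_n) (c : 'I_n -> R) :
  g \in unitmx -> fnorm g <= 1 -> (forall j, 0 <= c j) ->
  \sum_j c j = fnorm g -> \prod_j c j = nsq (\det g) ->
  forall j, 0 < c j /\ c j <= 1.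
Proof.
move=> gu g1 c0 cs cd j; split.
  rewrite lt_def c0 andbT.
  have : 0 < nsq (\det g) by rewrite nsq_gt0 -unitfE -unitmxE.
  rewrite -cd; apply: contraTneq => s0; rewrite (bigD1 j) //= s0 mul0r ltxx //.
rewrite (le_trans _ g1) // -cs (bigD1 j) //= lerDl sumr_ge0 //.
Qed.

End Hermitian.

(** * Capacity of a balanced tensor *)

Section Balanced.
Variable R : realType.
Local Notation C := R[i].
Variable d : nat.
Implicit Types n p : 'I_d -> nat.

(** The squared coordinates of [act u w] with [i]-th index [j] add up to the energy
of the slice of [w] along the [j]-th row of [u i]: the unitary matrices acting
on the other factors preserve norms. *)
Lemma marginal_le n (c : 'I_d -> R) (w : multi_index n -> C)
    (u : forall i, 'M[C]_(n i)) i (j : 'I_(n i)) :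
  balanced c w -> (forall i, u i \is unitarymx) ->
  \sum_(k : multi_index n | k i == j) nsq (act u w k) <= c i * nrm w.
Proof.
move=> cw uu; set y := act u w.
have n0 : (0 < (n i)%:R :> R) by rewrite ltr0n (leq_ltn_trans _ (ltn_ord j)).
rewrite -(ler_pM2l n0) mulrA.
suff -> : (n i)%:R * \sum_(k : multi_index n | k i == j) nsq (y k) = slice_energy (row j (u i)) w.
  by rewrite (le_trans (cw _ _)) // fnorm_row_unitary // mulr1.
apply: (@complexI R); rewrite rmorphM slice_energyE; congr (_ * _).
  by rewrite rmorph_nat.
have -> : at_pos ((row j (u i))^t* *m row j (u i)) =
    (fun l => (u l)^t* *m (at_pos (delta_mx j j : 'M[C]_(n i)) l *m u l)).
  apply/esym/at_posP => [|l il].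
    rewrite at_posE rowE trmx_mul map_mxM -!mulmxA; congr (_ *m _).
    rewrite mulmxA; congr (_ *m _).
    by rewrite trmx_delta map_delta_mx mul_delta_mx.
  by rewrite at_pos_neq // mul1mx; apply: mulmx1C; exact/unitarymxP.
rewrite -(@act_comp _ _ _ _ _ (fun l => (u l)^t*)) -dot_act -act_comp -/y.
rewrite /dot rmorph_sum /= big_mkcond /=; apply: eq_bigr => k _.
rewrite act_at_pos (bigD1 j) //= big1 ?addr0 => [|a aj].
  rewrite !mxE eqxx andbT; case: (eqVneq (k i) j) => [kj|_].
    rewrite mul1r /= nsqE; congr (_ * y _); apply/ffunP => l.
    have [<-|il] := eqVneq i l; first by rewrite subst_idx_same.
    by rewrite subst_idx_neq.
  by rewrite mul0r mulr0.
by rewrite !mxE (negbTE aj) andbF mul0r.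
Qed.

(** Convexity of the exponential, from the tangent at [s]; the weights [q] need not
be normalized. *)
Lemma jensen_expR (I : finType) (q t : I -> R) (s : R) :
  (forall k, 0 <= q k) -> (\sum_k q k) * s <= \sum_k q k * t k ->
  (\sum_k q k) * expR s <= \sum_k q k * expR (t k).
Proof.
move=> q0 st.
apply: (@le_trans _ _ (\sum_k q k * (expR s * (1 + (t k - s))))); last first.
  apply: ler_sum => k _; rewrite ler_wpM2l //.
  have -> : expR (t k) = expR s * expR (t k - s) by rewrite -expRD addrC subrK.
  by rewrite ler_wpM2l ?expR_ge0 ?expR_ge1Dx.
have -> : \sum_k q k * (expR s * (1 + (t k - s))) =
    expR s * (\sum_k q k + (\sum_k q k * t k - (\sum_k q k) * s)).
  rewrite mulr_suml -sumrB -big_split mulr_sumr; apply: eq_bigr => k _ /=.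
  by ring.
by rewrite mulrC ler_wpM2l ?expR_ge0 // lerDl subr_ge0.
Qed.

(** In singular coordinates [nrm (act h w)] is an average of the products of squared
singular values, weighted by the squared coordinates of [w].  By Jensen it is at
least the weighted geometric mean, in which the exponent of the [j]-th squared
singular value in factor [i] is a marginal of the weights, at most [c i].  As
these values are at most 1, raising their exponents to [c i] only decreases the
product. *)
Lemma balanced_capacity n (c : 'I_d -> R) (w : multi_index n -> C)
    (h : forall i, 'M[C]_(n i)) :
  balanced c w -> (forall i, h i \in unitmx) -> (forall i, fnorm (h i) <= 1) ->
  nrm w * \prod_i powR (nsq (\det (h i))) (c i) <= nrm (act h w).
Proof.
move=> cw hu h1.
have [u [sg sgP]] := simultaneous_singular_values h.
have uu i : u i \is unitarymx by have [] := sgP i.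
have sgd i : \prod_j sg i j = nsq (\det (h i)) by have [] := sgP i.
have sgb i j : 0 < sg i j /\ sg i j <= 1.
  by have [_ s0 ss sd _] := sgP i; exact: singular_value_bounds (hu i) (h1 i) s0 ss sd j.
have sg0 i j : 0 < sg i j by have [] := sgb i j.
have sg1 i j : sg i j <= 1 by have [] := sgb i j.
have dpos i : 0 < nsq (\det (h i)) by rewrite nsq_gt0 -unitfE -unitmxE.
have uU i : (u i)^t* *m u i = 1%:M by apply: mulmx1C; exact/unitarymxP.
have sgE i : (h i *m (u i)^t*)^t* *m (h i *m (u i)^t*) =
    diag_mx (\row_j (sg i j)%:C) by have [] := sgP i.
rewrite (nrm_act_singular w uu sgE).
have -> : \prod_i powR (nsq (\det (h i))) (c i) =
    expR (\sum_i c i * \sum_j ln (sg i j)).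
  rewrite expR_sum; apply: eq_bigr => i _; rewrite /powR gt_eqF //.
  congr (expR (_ * _)); rewrite -[RHS]expRK expR_sum -sgd; congr (ln _).
  by apply: eq_bigr => j _; rewrite lnK ?posrE.
rewrite -(nrm_act_isometry w uU).
under [leRHS]eq_bigr => k _ do rewrite mulrC.
have pE k : \prod_i sg i (k i) = expR (\sum_i ln (sg i (k i))).
  by rewrite expR_sum; apply: eq_bigr => i _; rewrite lnK ?posrE.
under [leRHS]eq_bigr => k _ do rewrite pE.
apply: jensen_expR => [k|]; first exact: nsq_ge0.
rewrite -/(nrm (act u w)) nrm_act_isometry //.
under [leRHS]eq_bigr do rewrite mulr_sumr.
rewrite [leRHS]exchange_big /= mulr_sumr; apply: ler_sum => i _.
rewrite mulrA mulr_sumr (partition_big (fun k : multi_index n => k i) xpredT) //=.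
apply: ler_sum => j _.
rewrite (eq_bigr (fun k => nsq (act u w k) * ln (sg i j))) => [|k /eqP -> //].
rewrite -mulr_suml ler_wnM2r ?ln_le0 //.
by rewrite (le_trans (marginal_le _ cw uu)) // mulrC.
Qed.

End Balanced.

(** * Balancing a tensor of positive capacity *)

(** Both sides are the determinant of the block matrix with rows [1 b] and [a 1],
eliminated in the two possible orders. *)
Lemma det_sub_rank1 (A : comNzRingType) n (a : 'cV[A]_n) (b : 'rV[A]_n) :
  \det (1%:M - a *m b) = 1 - (b *m a) 0 0.
Proof.
pose M := block_mx (1%:M : 'M_1) b a (1%:M : 'M_n).
have M1 : M = block_mx 1%:M 0 a 1%:M *m block_mx 1%:M b 0 (1%:M - a *m b).
  by rewrite mulmx_block !mul1mx !mul0mx !addr0 mulmx1 addrCA subrr addr0.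
have M2 : M = block_mx 1%:M b 0 1%:M *m block_mx (1%:M - b *m a) 0 a 1%:M.
  by rewrite mulmx_block !mul1mx !mul0mx mulmx1 !add0r subrK.
have := congr1 determinant M1; rewrite M2 !det_mulmx !det_ublock !det_lblock.
by rewrite !det1 !mul1r mulr1 det_mx11 !mxE /= mulr1n => <-.
Qed.

Section Minimize.
Variable R : realType.
Local Notation C := R[i].

(** [E] shrinks the line of [x] by [sqrt (1 - tau)] and fixes its orthogonal
complement. *)
Lemma rank1_contraction n (x : 'rV[C]_n) (tau : R) :
  fnorm x = 1 -> 0 <= tau -> tau < 1 ->
  exists E : 'M[C]_n, E^t* *m E = 1%:M - tau%:C *: (x^t* *m x) /\
    nsq (\det E) = 1 - tau.
Proof.
move=> x1 t0 t1; pose r := Num.sqrt (1 - tau); pose s := 1 - r.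
have xx : x *m x^t* = 1%:M.
  by apply/matrixP => a b; rewrite !ord1 -fnorm_rowE x1 rmorph1 mxE.
have r2 : r ^+ 2 = 1 - tau by rewrite sqr_sqrtr // subr_ge0 ltW.
exists (1%:M - s%:C *: (x^t* *m x)); split.
  have -> : (1%:M - s%:C *: (x^t* *m x))^t* = 1%:M - s%:C *: (x^t* *m x).
    apply/matrixP => a b; rewrite !mxE rmorphB rmorphM rmorph_nat eq_sym; congr (_ - _ * _).
      exact: conjc_real.
    by rewrite !big_ord1 !mxE rmorphM /= conjCK mulrC.
  have qq : x^t* *m x *m (x^t* *m x) = x^t* *m x.
    by rewrite mulmxA -[_ *m x *m x^t*]mulmxA xx mulmx1.
  have tE : tau%:C = s%:C + s%:C - s%:C * s%:C :> C.
    by rewrite -rmorphM -rmorphD -rmorphB; congr _%:C; rewrite /s; move: r2; rewrite expr2; lra.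
  rewrite mulmxBl mul1mx mulmxBr mulmx1 -scalemxAl -scalemxAr qq tE.
  rewrite scalerBl scalerDl -scalerA !opprB opprD -!addrA; congr (_ + _).
  exact: addrCA.
rewrite scalemxAl det_sub_rank1 -scalemxAr xx !mxE mulr1.
have -> : (1 - s%:C : C) = r%:C by rewrite -(rmorph1 (real_complex R)) -rmorphB /s subKr.
by rewrite nsq_real.
Qed.

(** To first order in [tau] the right-hand side is [1 - c tau]; the division by
[1 + tau ^+ 2] is the loss caused by an only approximate minimizer. *)
Lemma bernoulli_powR (c tau : R) : 0 <= c -> 0 < tau -> tau < 1 ->
  1 - tau * (c + tau * (1 + c)) <= powR (1 - tau) c / (1 + tau ^+ 2).
Proof.
move=> c0 t0 t1; have u0 : 0 < 1 - tau by rewrite subr_gt0.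
have lnb : - (tau / (1 - tau)) <= ln (1 - tau).
  have := @le_ln1Dx R (tau / (1 - tau)).
  have -> : 1 + tau / (1 - tau) = (1 - tau)^-1 by field; rewrite gt_eqF.
  rewrite lnV ?posrE // => /(_ _); rewrite lerNl; apply.
  by rewrite (lt_trans (ltrN10 _)) // divr_gt0.
have B : 1 - c * (tau / (1 - tau)) <= powR (1 - tau) c.
  rewrite /powR gt_eqF //; apply: le_trans (expR_ge1Dx _).
  by rewrite lerD2l -mulrN ler_wpM2l.
have t2 : 0 < 1 + tau ^+ 2 by rewrite ltr_pwDl ?sqr_ge0.
rewrite ler_pdivlMr //.
have P0 := powR_ge0 (1 - tau) c.
apply: (@le_trans _ _ ((1 - c * (tau / (1 - tau))) * (1 - tau ^+ 2) * (1 + tau ^+ 2))).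
  rewrite ler_wpM2r ?(ltW t2) //.
  have -> : (1 - c * (tau / (1 - tau))) * (1 - tau ^+ 2) = 1 - tau * (c + tau * (1 + c)).
    by field; rewrite gt_eqF.
  exact: lexx.
apply: (@le_trans _ _ (powR (1 - tau) c * (1 - tau ^+ 2) * (1 + tau ^+ 2))).
  by rewrite ler_wpM2r ?(ltW t2) // ler_wpM2r // subr_ge0 expr2 mulr_ile1 ?(ltW t0) ?(ltW t1).
rewrite -mulrA -[leRHS]mulr1 ler_wpM2l //.
have -> : (1 - tau ^+ 2) * (1 + tau ^+ 2) = 1 - (tau ^+ 2) ^+ 2 by ring.
by rewrite gerBl sqr_ge0.
Qed.

Lemma fnorm_scale_le1 n (M : 'M[C]_n) :
  exists2 s : R, 0 < s & fnorm (s%:C *: M) <= 1.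
Proof.
have f0 := fnorm_ge0 M.
(* The square of this factor times the squared norm f is f / (1 + f)^2. *)
exists (1 + fnorm M)^-1; first by rewrite invr_gt0 ltr_pwDl.
rewrite fnormZ nsq_real exprVn ler_pdivrMl ?exprn_gt0 ?ltr_pwDl // mulr1 expr2; nra.
Qed.

Variable d : nat.
Implicit Types n : 'I_d -> nat.

Lemma slice_energy_le n (c : 'I_d -> R) (w : multi_index n -> C) i :
  (forall x : 'rV[C]_(n i), fnorm x = 1 -> slice_energy x w <= (n i)%:R * c i * nrm w) ->
  forall x : 'rV[C]_(n i), slice_energy x w <= (n i)%:R * c i * fnorm x * nrm w.
Proof.
move=> H x; have [f0|fN0] := eqVneq (fnorm x) 0.
  rewrite f0 mulr0 mul0r (fnorm_eq0 f0) /slice_energy big1 // => k _.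
  by rewrite big1 ?nsq0 // => a _; rewrite mxE mul0r.
have f0 : 0 < fnorm x by rewrite lt_def fN0 fnorm_ge0.
pose s := (Num.sqrt (fnorm x))^-1.
have ss : nsq s%:C = (fnorm x)^-1 by rewrite nsq_real exprVn sqr_sqrtr // ltW.
have := H (s%:C *: x); rewrite fnormZ slice_energyZ ss mulVf // => /(_ erefl).
by rewrite ler_pdivrMl // => /le_trans; apply; rewrite le_eqVlt; apply/orP; left; apply/eqP; ring.
Qed.

(** Let [g] minimize the ratio of [nrm (act g v)] to the weighted determinant up to a
factor [1 + tau ^+ 2].  Shrinking [act g v] in factor [i] along a unit vector [x]
stays in the unit ball, multiplies the determinant factor by
[(1 - tau) ^ c i], and removes from the norm [tau] times the energy of the slice
along [x].  Since the ratio cannot drop much, that energy is at most about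
[c i] times the norm. *)
Lemma exists_balanced n (v : multi_index n -> C) (c : 'I_d -> R) (delta tau : R) :
  (forall i, 0 <= c i) -> 0 < delta -> 0 < tau -> tau < 1 ->
  (forall g : forall i, 'M[C]_(n i), (forall i, g i \in unitmx) ->
     (forall i, fnorm (g i) <= 1) ->
     delta * \prod_i powR (nsq (\det (g i))) (c i) <= nrm (act g v)) ->
  exists g : forall i, 'M[C]_(n i), [/\ forall i, g i \in unitmx,
    0 < nrm (act g v) & balanced (fun i => c i + tau * (1 + c i)) (act g v)].
Proof.
move=> c0 delta0 t0 t1 H.
pose ok (g : forall i, 'M[C]_(n i)) :=
  (forall i, g i \in unitmx) /\ (forall i, fnorm (g i) <= 1).
pose D (g : forall i, 'M[C]_(n i)) := \prod_i powR (nsq (\det (g i))) (c i).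
have D0 g : ok g -> 0 < D g.
  move=> [gu _]; apply: prodr_gt0 => i _; apply: powR_gt0.
  by rewrite nsq_gt0 -unitfE -unitmxE.
pose Q := [set nrm (act g v) / D g | g in ok]%classic.
have Qlb : lbound Q delta.
  move=> _ [g gok <-]; rewrite ler_pdivlMr ?D0 //.
  by apply: H; case: gok.
have Q0 : (Q !=set0)%classic.
  have S i := @cid2 _ _ _ (fnorm_scale_le1 (1%:M : 'M[C]_(n i))).
  exists (nrm (act (fun i => (s2val (S i))%:C *: 1%:M) v) / D (fun i => (s2val (S i))%:C *: 1%:M)).
  exists (fun i => (s2val (S i))%:C *: 1%:M) => //; split => i; last by case: (S i).
  rewrite unitmxZ ?unitmx1 // unitfE; case: (S i) => s s0 _ /=.
  by rewrite -(rmorph0 (real_complex R)) (inj_eq (@complexI R)) gt_eqF.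
have Qinf : has_inf Q by split => //; exists delta.
have I0 : delta <= inf Q by apply: lb_le_inf.
have tI : 0 < inf Q * tau ^+ 2 by rewrite mulr_gt0 ?exprn_gt0 // (lt_le_trans delta0 I0).
have [_ [g gok <-] gI] := inf_adherent tI Qinf.
have N0 : 0 < nrm (act g v).
  have [gu g1] := gok; apply: lt_le_trans (H g gu g1).
  by rewrite mulr_gt0 // D0.
exists g; split => //; first by case: gok.
move=> i; apply: (@slice_energy_le n (fun i => c i + tau * (1 + c i))) => x x1 /=.
set w := act g v in N0 gI *.
have n0 : (0 < (n i)%:R :> R).
  rewrite ltr0n lt0n; apply/eqP => ni; move: x1; rewrite /fnorm big_ord1.
  rewrite big1 => [/esym/eqP|j _]; first by rewrite oner_eq0.
  by have := ltn_ord j; rewrite [X in (_ < X)%N]ni.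
have [E [EE Edet]] := rank1_contraction x1 (ltW t0) t1.
pose Eg j := at_pos E j *m g j.
have Egok : ok Eg.
  split=> j; rewrite /Eg.
    rewrite unitmx_mul (gok.1 j) andbT.
    have [<-|ij] := eqVneq i j; last by rewrite at_pos_neq // unitmx1.
    by rewrite at_posE unitmxE unitfE -nsq_gt0 Edet subr_gt0.
  have [ij|ij] := eqVneq i j; last by rewrite at_pos_neq // mul1mx; apply: gok.2.
  rewrite -{j}ij at_posE; apply: le_trans (gok.2 i).
  rewrite -lecR fnormE trmx_mul map_mxM mulmxA -[_ *m _ *m E]mulmxA EE.
  rewrite mulmxBr mulmx1 mulmxBl linearB /= -fnormE -scalemxAr -scalemxAl linearZ /=.
  rewrite mulmxA -map_mxM -trmx_mul -mulmxA -fnormE -rmorphM -rmorphB lecR.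
  by rewrite gerBl mulr_ge0 ?fnorm_ge0 ?ltW.
have DEg : D Eg = D g * powR (1 - tau) (c i).
  rewrite /D (bigD1 i) //= [in RHS](bigD1 i) //= {1}/Eg at_posE det_mulmx nsqM Edet.
  rewrite powRM ?nsq_ge0 ?subr_ge0 ?(ltW t1) // -mulrA mulrC; congr (_ * _ * _).
  by apply: eq_bigr => j ij; rewrite /Eg at_pos_neq ?mul1mx // eq_sym.
have NEg : nrm (act Eg v) = nrm w - tau * (slice_energy x w / (n i)%:R).
  rewrite /Eg -(act_comp (at_pos E) g) -/w.
  apply: (@complexI R); rewrite rmorphB !rmorphM /= slice_energyE fmorphV rmorph_nat.
  rewrite mulrAC mulfV ?mul1r; last by rewrite pnatr_eq0 -(@pnatr_eq0 R) gt_eqF.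
  rewrite nrm_act; have -> : (fun j => (at_pos E j)^t* *m at_pos E j) = at_pos (E^t* *m E).
    apply: at_posP => [|j ij]; first by rewrite at_posE.
    by rewrite at_pos_neq // trmx1 map_mx1 mulmx1.
  rewrite EE nrmE /dot mulr_sumr -sumrB; apply: eq_bigr => k _.
  rewrite -scaleNr act_at_posDZ -at_pos1 act1 mulrDr mulNr mulrN; congr (_ - _).
  by rewrite mulrCA.
have IEg : inf Q <= nrm (act Eg v) / D Eg.
  by apply: ge_inf; [exists delta|exists Eg].
(* The infimum bounds the ratio at [Eg] from below and, by the choice of [g],
   almost equals the ratio at [g]. *)
have IEg2 : inf Q * D g * powR (1 - tau) (c i) <= nrm w - tau * (slice_energy x w / (n i)%:R).
  by move: IEg; rewrite ler_pdivlMr ?D0 // NEg DEg [leLHS]mulrA.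
have p0 := powR_ge0 (1 - tau) (c i).
have gI2 : nrm w / (1 + tau ^+ 2) <= inf Q * D g.
  have t2 : 0 < 1 + tau ^+ 2 by rewrite ltr_pwDl ?sqr_ge0.
  rewrite ler_pdivrMr //; move: (ltW gI); rewrite ler_pdivrMr ?D0 // => /le_trans; apply.
  by rewrite le_eqVlt; apply/orP; left; apply/eqP; ring.
have := bernoulli_powR (c0 i) t0 t1.
move=> /(ler_wpM2l (ltW N0)) B.
have K : nrm w * (powR (1 - tau) (c i) / (1 + tau ^+ 2)) <=
    nrm w - tau * (slice_energy x w / (n i)%:R).
  apply: le_trans IEg2; rewrite mulrA mulrAC.
  by rewrite ler_wpM2r.
have := le_trans B K; rewrite mulrBr mulr1 lerD2l lerN2 [leRHS]mulrCA ler_pM2l //.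
rewrite ler_pdivrMr // => /le_trans; apply.
by rewrite le_eqVlt; apply/orP; left; apply/eqP; ring.
Qed.

End Minimize.

(** * One-parameter bounds force positive capacity *)

(** The lower bound [r] for the ratios attached to the one-parameter subgroups
[diag (t ^ lam)] in all coordinate systems [b]: the coordinates of [act b v] are
multiplied by [t] to the power [\sum_i lam i (k i)], and the determinant of the
[i]-th matrix has valuation [\sum_j lam i j]. *)
Definition one_param_bound (K : fieldType) (R : realType) (d : nat) (n : 'I_d -> nat)
    (r : R) (alpha : 'I_d -> R) (v : multi_index n -> K) : Prop :=
  forall (b : forall i, 'M[K]_(n i)) (lam : forall i, 'I_(n i) -> nat) (m : nat),
    (forall i, b i \in unitmx) -> (0 < m)%N ->
    (forall k, act b v k != 0 -> (m <= \sum_i lam i (k i))%N) ->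
    r * m%:R <= \sum_i alpha i * (\sum_j lam i j)%:R.

Section ComplexContinuity.
Variables (R : realType) (T : topologicalType).
Implicit Types f g : T -> R[i].

(** Continuity is expressed through real and imaginary parts, so that only the
topology of the real line is involved. *)
Definition ccont f :=
  continuous (fun x => complex.Re (f x)) /\ continuous (fun x => complex.Im (f x)).

Lemma ReM (z w : R[i]) : complex.Re (z * w) =
  complex.Re z * complex.Re w - complex.Im z * complex.Im w.
Proof. by case: z; case: w. Qed.

Lemma ImM (z w : R[i]) : complex.Im (z * w) =
  complex.Re z * complex.Im w + complex.Im z * complex.Re w.
Proof. by case: z; case: w. Qed.

Lemma ReD (z w : R[i]) : complex.Re (z + w) = complex.Re z + complex.Re w.
Proof. by case: z; case: w. Qed.

Lemma ImD (z w : R[i]) : complex.Im (z + w) = complex.Im z + complex.Im w.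
Proof. by case: z; case: w. Qed.

Lemma ccont_cst c : ccont (fun=> c).
Proof. by split; exact: cst_continuous. Qed.

Lemma ccontD f g : ccont f -> ccont g -> ccont (fun x => f x + g x).
Proof.
move=> [rf jf] [rg jg]; split.
  under eq_fun do rewrite ReD.
  by move=> x; apply: cvgD; [exact: rf|exact: rg].
under eq_fun do rewrite ImD.
by move=> x; apply: cvgD; [exact: jf|exact: jg].
Qed.

Lemma ccontM f g : ccont f -> ccont g -> ccont (fun x => f x * g x).
Proof.
move=> [rf jf] [rg jg]; split.
  under eq_fun do rewrite ReM.
  move=> x; apply: cvgB; apply: cvgM;
    [exact: rf|exact: rg|exact: jf|exact: jg].
under eq_fun do rewrite ImM.
move=> x; apply: cvgD; apply: cvgM;
  [exact: rf|exact: jg|exact: jf|exact: rg].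
Qed.

Lemma ccont_sum (I : Type) (r : seq I) (P : pred I) (F : I -> T -> R[i]) :
  (forall i, ccont (F i)) -> ccont (fun x => \sum_(i <- r | P i) F i x).
Proof.
move=> cF; elim: r => [|i r IH].
  by under eq_fun do rewrite big_nil; exact: ccont_cst.
under eq_fun do rewrite big_cons; case: (P i) => //; exact: ccontD.
Qed.

Lemma ccont_prod (I : Type) (r : seq I) (P : pred I) (F : I -> T -> R[i]) :
  (forall i, ccont (F i)) -> ccont (fun x => \prod_(i <- r | P i) F i x).
Proof.
move=> cF; elim: r => [|i r IH].
  by under eq_fun do rewrite big_nil; exact: ccont_cst.
under eq_fun do rewrite big_cons; case: (P i) => //; exact: ccontM.
Qed.

Lemma ccont_nsq f : ccont f -> continuous (fun x => nsq (f x)).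
Proof.
move=> [rf jf]; rewrite /nsq; under eq_fun do rewrite !expr2.
move=> x; apply: cvgD; apply: cvgM; [exact: rf|exact: rf|exact: jf|exact: jf].
Qed.

Lemma addr_continuous (f g : T -> R) :
  continuous f -> continuous g -> continuous (fun x => f x + g x).
Proof. by move=> cf cg x; apply: cvgD; [exact: cf|exact: cg]. Qed.

Lemma mulr_continuous (f g : T -> R) :
  continuous f -> continuous g -> continuous (fun x => f x * g x).
Proof. by move=> cf cg x; apply: cvgM; [exact: cf|exact: cg]. Qed.

Lemma continuous_sumr (I : Type) (r : seq I) (P : pred I) (F : I -> T -> R) :
  (forall i, continuous (F i)) -> continuous (fun x => \sum_(i <- r | P i) F i x).
Proof.
move=> cF; elim: r => [|i r IH].
  by under eq_fun do rewrite big_nil; exact: cst_continuous.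
under eq_fun do rewrite big_cons; case: (P i) => // x.
by apply: cvgD; [exact: cF|exact: IH].
Qed.

Lemma continuous_prodr (I : Type) (r : seq I) (P : pred I) (F : I -> T -> R) :
  (forall i, continuous (F i)) -> continuous (fun x => \prod_(i <- r | P i) F i x).
Proof.
move=> cF; elim: r => [|i r IH].
  by under eq_fun do rewrite big_nil; exact: cst_continuous.
under eq_fun do rewrite big_cons; case: (P i) => // x.
by apply: cvgM; [exact: cF|exact: IH].
Qed.

End ComplexContinuity.

Section Capacity.
Variable R : realType.
Local Notation C := R[i].
Variable d : nat.
Implicit Types n : 'I_d -> nat.

(** A support [S] for which no one-parameter subgroup has ratio below [r]. *)
Definition obstructing n (r : R) (alpha : 'I_d -> R) (S : {set multi_index n}) : Prop :=
  forall lam : forall i, 'I_(n i) -> nat, exists2 k : multi_index n, k \in S &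
    r * (\sum_i lam i (k i))%:R <= \sum_i alpha i * (\sum_j lam i j)%:R.

(** Apply the bound with [m] the least weight on the support.  The support is not
empty, since otherwise the zero weight would violate the bound for [m = 1]. *)
Lemma obstructing_support n r alpha (v : multi_index n -> C) (b : forall i, 'M[C]_(n i)) :
  0 < r -> (forall i, 0 <= alpha i) ->
  one_param_bound r alpha v -> (forall i, b i \in unitmx) ->
  obstructing r alpha [set k | act b v k != 0].
Proof.
move=> r0 a0 cv bu lam; set S := [set k | _].
have [k0 k0S] : exists k, k \in S.
  apply: contrapT => /forallNP S0.
  have : r * 1%:R <= \sum_i alpha i * (\sum_(j < n i) 0)%:R.
    by apply: (cv b (fun _ _ => 0%N)) => // k vk; case: (S0 k); rewrite inE.
  rewrite big1 => [|i _]; first by rewrite mulr1 leNgt r0.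
  by rewrite big1 // mulr0.
have [k kS kmin] := @arg_minnP _ k0 (mem S) (fun k => \sum_i lam i (k i))%N k0S.
exists k => //; set m := (\sum_i lam i (k i))%N in kmin *.
have [m0|m0] := posnP m.
  by rewrite m0 mulr0 sumr_ge0 // => i _; rewrite mulr_ge0.
by apply: (cv b) => // k' vk; apply: kmin; rewrite -[mem S k']/(k' \in S) inE.
Qed.

Definition entry_index := ('I_d * nat * nat * bool)%type.

(** Tuples of complex matrices are parametrized by families of real numbers, whose
product topology makes boxes compact. *)
Definition entry_space := prod_topology (fun _ : entry_index => R).

Definition mx_of_entries n (x : entry_space) i : 'M[C]_(n i) :=
  \matrix_(a, b) Complex (x (i, a : nat, b : nat, false)) (x (i, a : nat, b : nat, true)).

Lemma ccont_entries n i a b : ccont (fun x : entry_space => mx_of_entries n x i a b).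
Proof.
split.
  rewrite (_ : (fun x : entry_space => complex.Re (mx_of_entries n x i a b)) =
    @proj entry_index (fun=> R) (i, a : nat, b : nat, false)).
    by apply: (@proj_continuous entry_index (fun=> R)).
  by apply/funext => x; rewrite mxE.
rewrite (_ : (fun x : entry_space => complex.Im (mx_of_entries n x i a b)) =
  @proj entry_index (fun=> R) (i, a : nat, b : nat, true)).
  by apply: (@proj_continuous entry_index (fun=> R)).
by apply/funext => x; rewrite mxE.
Qed.

(** A polynomial substitute for the discontinuous map sending [u] to the support of
[act u v]: it is positive as soon as that support is obstructing. *)
Definition obstruction n r alpha (v : multi_index n -> C) (u : forall i, 'M[C]_(n i)) : R :=
  \sum_(S : {set multi_index n} | `[< obstructing r alpha S >]) \prod_(k in S) nsq (act u v k).

(** The penalty vanishes only when every determinant has modulus 1; it makes the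
function positive on the whole box of real parameters between -1 and 1, invertible
tuples or not, so that a minimum over the box is enough. *)
Definition penalized_obstruction n r alpha (v : multi_index n -> C) (x : entry_space) : R :=
  obstruction r alpha v (mx_of_entries n x) + \sum_i (nsq (\det (mx_of_entries n x i)) - 1) ^+ 2.

Lemma ccont_act_entries n (v : multi_index n -> C) k :
  ccont (fun x : entry_space => act (mx_of_entries n x) v k).
Proof.
rewrite /act; apply: (@ccont_sum _ _ _ _ _
  (fun (l : multi_index n) (x : entry_space) =>
     (\prod_i mx_of_entries n x i (k i) (l i)) * v l)) => l.
apply: (@ccontM _ _
  (fun x : entry_space => \prod_i mx_of_entries n x i (k i) (l i)));
  last exact: ccont_cst.
apply: (@ccont_prod _ _ _ _ _ (fun i (x : entry_space) => mx_of_entries n x i (k i) (l i))) => i.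
exact: ccont_entries.
Qed.

Lemma ccont_det_entries n i : ccont (fun x : entry_space => \det (mx_of_entries n x i)).
Proof.
rewrite /determinant; apply: (@ccont_sum _ _ _ _ _ (fun (s : {perm 'I_(n i)}) (x : entry_space) =>
  (-1) ^+ s * \prod_j mx_of_entries n x i j (s j))) => s.
apply: (@ccontM _ _ (fun=> (-1) ^+ s)); first exact: ccont_cst.
apply: (@ccont_prod _ _ _ _ _ (fun j (x : entry_space) => mx_of_entries n x i j (s j))) => j.
exact: ccont_entries.
Qed.

Lemma continuous_penalized_obstruction n r alpha (v : multi_index n -> C) :
  continuous (penalized_obstruction r alpha v).
Proof.
have c1 : continuous (fun x : entry_space => obstruction r alpha v (mx_of_entries n x)).
  apply: (@continuous_sumr _ _ _ _ _ (fun (S : {set multi_index n}) (x : entry_space) =>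
    \prod_(k in S) nsq (act (mx_of_entries n x) v k))) => S.
  apply: (@continuous_prodr _ _ _ _ _ (fun (k : multi_index n) (x : entry_space) =>
    nsq (act (mx_of_entries n x) v k))) => k.
  apply: ccont_nsq; exact: ccont_act_entries.
have c2 : continuous (fun x : entry_space => \sum_i (nsq (\det (mx_of_entries n x i)) - 1) ^+ 2).
  apply: (@continuous_sumr _ _ _ _ _ (fun i (x : entry_space) =>
    (nsq (\det (mx_of_entries n x i)) - 1) ^+ 2)) => i.
  have H := @addr_continuous _ _ _ _ (ccont_nsq (ccont_det_entries n i))
    (@cst_continuous entry_space R (-1)).
  exact: (mulr_continuous H H).
exact: (addr_continuous c1 c2).
Qed.

Lemma nsq_det_unitary (m : nat) (u : 'M[C]_m) : u \is unitarymx -> nsq (\det u) = 1.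
Proof.
move=> /unitarymxP/(congr1 determinant); rewrite det_mulmx det_map_mx det_tr det1 => H.
by apply: (@complexI R); rewrite nsqE mulrC H.
Qed.

(** The real and imaginary parts of the entries of unitary matrices lie between -1
and 1, and on that compact box the penalized function is continuous and positive,
hence bounded away from 0. *)
Lemma obstruction_lower n r alpha (v : multi_index n -> C) :
  0 < r -> (forall i, 0 <= alpha i) -> one_param_bound r alpha v ->
  exists2 delta : R, 0 < delta & forall u : forall i, 'M[C]_(n i),
    (forall i, u i \is unitarymx) -> delta <= obstruction r alpha v u.
Proof.
move=> r0 a0 cv.
pose A := [set x : entry_space | forall j, `[-1, 1]%classic (x j)]%classic.
have cA : compact A.
  apply: (@tychonoff entry_index (fun=> R) (fun=> `[-1, 1]%classic)) => j.
  exact: segment_compact.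
have A0 : (A !=set0)%classic.
  by exists (fun=> 0) => j /=; rewrite in_itv /= oppr_le0 ler01.
have psi_ge0 u : 0 <= obstruction r alpha v u.
  by rewrite sumr_ge0 // => S _; rewrite prodr_ge0 // => k _; exact: nsq_ge0.
have sq_ge0 x : 0 <= \sum_i (nsq (\det (mx_of_entries n x i)) - 1) ^+ 2.
  by rewrite sumr_ge0 // => i _; exact: sqr_ge0.
have [x0 _ x0min] := compact_EVT_min A0 cA
  (continuous_subspaceT (@continuous_penalized_obstruction n r alpha v)).
exists (penalized_obstruction r alpha v x0).
  rewrite lt_def addr_ge0 // andbT; apply/negP => /eqP.
  move=> /eqP; rewrite paddr_eq0 // => /andP[/eqP p0 /eqP s0].
  have det1 i : nsq (\det (mx_of_entries n x0 i)) = 1.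
    apply/eqP; rewrite -subr_eq0 -sqrf_eq0; apply/eqP.
    by move/psumr_eq0P : s0 => /(_ (fun i _ => sqr_ge0 _) i isT).
  have gS : obstructing r alpha [set k | act (mx_of_entries n x0) v k != 0].
    apply: obstructing_support => // i; rewrite unitmxE unitfE -nsq_gt0 det1 //.
  move/psumr_eq0P : p0 => /(_ _)/(_ [set k | act (mx_of_entries n x0) v k != 0]) H.
  have : 0 < \prod_(k in [set k | act (mx_of_entries n x0) v k != 0])
      nsq (act (mx_of_entries n x0) v k).
    by apply: prodr_gt0 => k; rewrite inE nsq_gt0.
  rewrite H ?ltxx //; last exact/asboolP.
  by move=> S _; rewrite prodr_ge0 // => k _; exact: nsq_ge0.
move=> u uu.
pose x : entry_space := fun j => let: (i, a, b, e) := j in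
  if insub a is Some a' then if insub b is Some b' then
    if e then complex.Im (u i a' b') else complex.Re (u i a' b') else 0 else 0.
have xu : mx_of_entries n x = u.
  apply/functional_extensionality_dep => i; apply/matrixP => a b.
  by rewrite mxE /x !valK; case: (u i a b).
have -> : obstruction r alpha v u = penalized_obstruction r alpha v x.
  rewrite /penalized_obstruction xu big1 ?addr0 // => i _.
  by rewrite nsq_det_unitary // subrr expr0n.
apply: x0min; rewrite inE => -[[[i a] b] e] /=; rewrite in_itv /= -ler_norml.
case: insubP => [a' _ _|]; last by rewrite normr0 ler01.
case: insubP => [b' _ _|]; last by rewrite normr0 ler01.
have : nsq (u i a' b') <= 1.
  have -> : u i a' b' = row a' (u i) 0 b' by rewrite mxE.
  by rewrite -(fnorm_row_unitary a' (uu i)) nsq_le_fnorm.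
have sq_norm (y : R) : `|y| <= 1 <-> y ^+ 2 <= 1.
  by rewrite -real_normK ?num_real // expr_le1.
rewrite /nsq => u1; case: ifP => _; apply/sq_norm; apply: le_trans u1.
  by rewrite lerDr sqr_ge0.
by rewrite lerDl sqr_ge0.
Qed.

End Capacity.

Section Rounding.
Variable R : realType.
Local Notation h := (2^-1 : R).

(** Rounding to powers of 1/2 turns real singular values into integral weights at
the cost of a bounded factor. *)
Lemma dyadic_round (x : R) : 0 < x -> x <= 1 ->
  exists l : nat, h ^+ l <= x /\ x <= 2 * h ^+ l.
Proof.
move=> x0 x1.
have ex : exists l, h ^+ l <= x.
  exists (Num.bound x^-1); rewrite exprVn -[leRHS]invrK lef_pV2 ?posrE ?exprn_gt0 ?invr_gt0 //.
  apply: ltW; apply: lt_trans (archi_boundP _) _; first by rewrite invr_ge0 ltW.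
  by rewrite -natrX ltr_nat ltn_expl.
have [l lx lmin] := ex_minnP ex.
exists l; split => //; case: l lx lmin => [|l] lx lmin.
  by rewrite expr0 mulr1 (le_trans x1) // ler1n.
rewrite exprS mulVKf ?pnatr_eq0 // ltW // ltNge; apply/negP => /lmin.
by rewrite ltnn.
Qed.

Lemma powR2_half (l : nat) (x : R) : l%:R <= x -> 1 <= h ^+ l * powR 2 x.
Proof.
move=> lx; rewrite exprVn ler_pdivlMl ?exprn_gt0 // mulr1 -powR_mulrn //.
by rewrite ler_powR // ler1n.
Qed.

Lemma prod_le_factor (I : finType) (S : {set I}) (y : I -> R) (B : R) k0 :
  1 <= B -> (forall k, 0 <= y k <= B) -> k0 \in S ->
  \prod_(k in S) y k <= B ^+ #|I| * y k0.
Proof.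
move=> B1 yB k0S; rewrite (big_setD1 k0) //= mulrC ler_wpM2r //.
  by case/andP: (yB k0).
apply: (@le_trans _ _ (\prod_(k in S :\ k0) B)); first exact: ler_prod.
by rewrite prodr_const ler_weXn2l // max_card.
Qed.

End Rounding.

Section PositiveCapacity.
Variable R : realType.
Local Notation C := R[i].
Local Notation h := (2^-1 : R).
Variable d : nat.
Implicit Types n : 'I_d -> nat.

(** In singular coordinates [nrm (act g v)] is the sum over [k] of [nsq (act u v k)]
times a product of squared singular values, which are rounded down to powers
[h ^+ lam i j] of 1/2.  For an obstructing [S] some [k] in [S] has weight at most
[L / r], with [L] the weighted total of [lam], so its term is at least a constant
times [h ^ (L / r)] times the product of [nsq (act u v k)] over [S].  Summing over
all obstructing [S] replaces these products by [obstruction], which is bounded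
below uniformly in [u]. *)
Lemma capacity_gt0 n r alpha (v : multi_index n -> C) :
  0 < r -> (forall i, 0 <= alpha i) -> one_param_bound r alpha v ->
  exists2 delta : R, 0 < delta & forall g : forall i, 'M[C]_(n i),
    (forall i, g i \in unitmx) -> (forall i, fnorm (g i) <= 1) ->
    delta * \prod_i powR (nsq (\det (g i))) (alpha i / r) <= nrm (act g v).
Proof.
move=> r0 a0 cv; have [delta0 d0 dpsi] := obstruction_lower r0 a0 cv.
(* [B] absorbs all factors but one of a product over an obstructing set. *)
pose B := (1 + nrm v) ^+ #|{: multi_index n}|.
have v1 : 1 <= 1 + nrm v by rewrite lerDl nrm_ge0.
have B0 : 0 < B by rewrite exprn_gt0 // (lt_le_trans ltr01).
pose M := \sum_(S : {set multi_index n} | `[< obstructing r alpha S >]) (1 : R).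
have M0 : 0 <= M by rewrite sumr_ge0.
pose c i := alpha i / r.
have c0 i : 0 <= c i by rewrite divr_ge0 // ltW.
(* [C0] is the loss from rounding the [n i] singular values in each factor. *)
pose C0 := \prod_i powR (2 ^+ n i) (c i) : R.
have C00 : 0 < C0 by apply: prodr_gt0 => i _; rewrite powR_gt0 // exprn_gt0.
exists (delta0 / (C0 * (B * (M + 1)))) => [|g gu g1].
  by rewrite divr_gt0 // !mulr_gt0 // ltr_wpDl.
have [u [sg sgP]] := simultaneous_singular_values g.
have uu i : u i \is unitarymx by have [] := sgP i.
have sgd i : \prod_j sg i j = nsq (\det (g i)) by have [] := sgP i.
have sgb i j : 0 < sg i j /\ sg i j <= 1.
  by have [_ s0 ss sd _] := sgP i; exact: singular_value_bounds (gu i) (g1 i) s0 ss sd j.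
have sgE i : (g i *m (u i)^t*)^t* *m (g i *m (u i)^t*) =
    diag_mx (\row_j (sg i j)%:C) by have [] := sgP i.
have lamP i j := cid (dyadic_round (proj1 (sgb i j)) (proj2 (sgb i j))).
pose lam i j : nat := sval (lamP i j).
have lam1 i j : h ^+ lam i j <= sg i j by rewrite /lam; case: (lamP i j) => l [].
have lam2 i j : sg i j <= 2 * h ^+ lam i j by rewrite /lam; case: (lamP i j) => l [].
have uU i : (u i)^t* *m u i = 1%:M by apply: mulmx1C; exact/unitarymxP.
set y := act u v.
have yB k : 0 <= nsq (y k) <= 1 + nrm v.
  rewrite nsq_ge0 /= (le_trans (nsq_le_nrm _ _)) // nrm_act_isometry //.
  by rewrite lerDr.
pose wt (k : multi_index n) := (\sum_i lam i (k i))%N.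
pose N := \sum_k h ^+ wt k * nsq (y k).
have h0 l : 0 <= h ^+ l by rewrite exprn_ge0 // invr_ge0.
have N0 : 0 <= N by rewrite sumr_ge0 // => k _; rewrite mulr_ge0 ?nsq_ge0.
have NN : N <= nrm (act g v).
  rewrite (nrm_act_singular v uu sgE); apply: ler_sum => k _.
  rewrite ler_wpM2r ?nsq_ge0 // /wt -prodrXr; apply: ler_prod => i _.
  by rewrite h0 lam1.
pose L := \sum_i alpha i * (\sum_j lam i j)%:R.
have psiN : delta0 <= B * N * powR 2 (L / r) * M.
  apply: le_trans (dpsi u uu) _; rewrite mulr_sumr; apply: ler_sum => S /asboolP gS.
  rewrite mulr1; have [k kS kL] := gS lam.
  apply: le_trans (prod_le_factor v1 yB kS) _; rewrite -!mulrA ler_wpM2l ?(ltW B0) //.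
  apply: (@le_trans _ _ ((h ^+ wt k * nsq (y k)) * powR 2 (L / r))).
    rewrite mulrAC -[leLHS]mul1r ler_wpM2r ?nsq_ge0 // powR2_half //.
    by rewrite ler_pdivlMr // mulrC.
  rewrite ler_wpM2r ?powR_ge0 // /N (bigD1 k) //= lerDl sumr_ge0 // => l _.
  by rewrite mulr_ge0 ?nsq_ge0.
have detL : \prod_i powR (nsq (\det (g i))) (c i) <= C0 * powR h (L / r).
  have -> : C0 * powR h (L / r) =
      \prod_i powR (\prod_j (2 * h ^+ lam i j)) (c i).
    have hpos : (0 : R) < h by rewrite invr_gt0.
    rewrite /L mulr_suml /C0.
    have -> : powR h (\sum_i alpha i * (\sum_j lam i j)%:R / r) =
        \prod_i powR (h ^+ (\sum_j lam i j)) (c i).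
      rewrite /powR gt_eqF // mulr_suml expR_sum; apply: eq_bigr => i _.
      rewrite gt_eqF ?exprn_gt0 // lnXn // /c -mulr_natl; congr expR; ring.
    rewrite -big_split /=; apply: eq_bigr => i _.
    rewrite -powRM ?exprn_ge0 ?invr_ge0 //; congr (powR _ _).
    by rewrite big_split /= prodr_const card_ord prodrXr.
  apply: ler_prod => i _; rewrite powR_ge0 /= -sgd ge0_ler_powR ?nnegrE ?c0 //.
  - by rewrite prodr_ge0 // => j _; rewrite ltW //; case: (sgb i j).
  - by rewrite prodr_ge0 // => j _; rewrite mulr_ge0.
  - by apply: ler_prod => j _; rewrite lam2 andbT ltW //; case: (sgb i j).
apply: le_trans NN; rewrite -mulrA.
have P1 : powR 2 (L / r) * powR h (L / r) = 1 :> R.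
  by rewrite -powRM ?invr_ge0 // mulfV ?pnatr_eq0 // powR1.
have K0 : 0 < C0 * (B * (M + 1)) by rewrite !mulr_gt0 // ltr_wpDl.
rewrite mulrCA ler_pdivrMl // mulrC.
apply: (@le_trans _ _ (C0 * powR h (L / r) * delta0)); first by rewrite ler_wpM2r // ltW.
apply: (@le_trans _ _ (C0 * powR h (L / r) * (B * N * powR 2 (L / r) * M))).
  by rewrite ler_wpM2l // mulr_ge0 ?powR_ge0 // ltW.
have -> : C0 * powR h (L / r) * (B * N * powR 2 (L / r) * M) =
   C0 * (B * N * M) * (powR 2 (L / r) * powR h (L / r)) by ring.
rewrite P1 mulr1 -!mulrA ler_wpM2l ?(ltW C00) // ler_wpM2l ?(ltW B0) //.
by rewrite mulrC ler_wpM2r // lerDl.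
Qed.

End PositiveCapacity.

(** * Kronecker products *)

Section Kronecker.
Variable R : realType.
Local Notation C := R[i].
Variable d : nat.
Implicit Types n p : 'I_d -> nat.

(** Inverse of the row-major numbering [mxvec_index]. *)
Definition unpair (m n : nat) (a : 'I_(m * n)) : 'I_m * 'I_n :=
  enum_val (cast_ord (esym (mxvec_cast m n)) a).

Lemma mxvec_indexK (m n : nat) (a : 'I_m) (b : 'I_n) : unpair (mxvec_index a b) = (a, b).
Proof. by rewrite /unpair /mxvec_index cast_ordK enum_rankK. Qed.

Lemma unpairK (m n : nat) (a : 'I_(m * n)) : mxvec_index (unpair a).1 (unpair a).2 = a.
Proof. by case/mxvec_indexP: a => i j; rewrite mxvec_indexK. Qed.

Definition fst_idx n p (k : multi_index (fun i => (n i * p i)%N)) : multi_index n :=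
  [ffun i => (unpair (k i)).1].
Definition snd_idx n p (k : multi_index (fun i => (n i * p i)%N)) : multi_index p :=
  [ffun i => (unpair (k i)).2].

Definition kron n p (v : multi_index n -> C) (w : multi_index p -> C) :
    multi_index (fun i => (n i * p i)%N) -> C :=
  fun k => v (fst_idx k) * w (snd_idx k).

Definition pair_idx n p (kl : multi_index n * multi_index p) :
    multi_index (fun i => (n i * p i)%N) :=
  [ffun i => mxvec_index (kl.1 i) (kl.2 i)].

Lemma fst_pair_idx n p (k : multi_index n) (l : multi_index p) : fst_idx (pair_idx (k, l)) = k.
Proof. by apply/ffunP => i; rewrite !ffunE mxvec_indexK. Qed.

Lemma snd_pair_idx n p (k : multi_index n) (l : multi_index p) : snd_idx (pair_idx (k, l)) = l.
Proof. by apply/ffunP => i; rewrite !ffunE mxvec_indexK. Qed.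

Lemma sum_pair_idx (A : nmodType) n p (F : multi_index (fun i => (n i * p i)%N) -> A) :
  \sum_k F k = \sum_(k : multi_index n) \sum_(l : multi_index p) F (pair_idx (k, l)).
Proof.
rewrite pair_bigA /= (reindex (@pair_idx n p)) /=.
  by apply: eq_bigr => -[].
exists (fun k => (fst_idx k, snd_idx k)) => [[k l] _|k _] /=.
  by rewrite fst_pair_idx snd_pair_idx.
by apply/ffunP => i; rewrite !ffunE unpairK.
Qed.

Lemma nrm_kron n p (v : multi_index n -> C) (w : multi_index p -> C) :
  nrm (kron v w) = nrm v * nrm w.
Proof.
rewrite /nrm sum_pair_idx mulr_suml; apply: eq_bigr => k _.
rewrite mulr_sumr; apply: eq_bigr => l _.
by rewrite /kron fst_pair_idx snd_pair_idx nsqM.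
Qed.

Lemma subst_idx_pair n p (k : multi_index n) (l : multi_index p) i a b :
  subst_idx (pair_idx (k, l)) (mxvec_index a b : 'I_(n i * p i)) =
  pair_idx (subst_idx k a, subst_idx l b).
Proof.
apply/ffunP => j; have [<-|ij] := eqVneq i j.
  by rewrite subst_idx_same [RHS]ffunE /= !subst_idx_same.
by rewrite subst_idx_neq // [LHS]ffunE [RHS]ffunE /= !subst_idx_neq.
Qed.

Lemma sum_mxvec (A : nmodType) (m n : nat) (F : 'I_(m * n) -> A) :
  \sum_k F k = \sum_a \sum_b F (mxvec_index a b).
Proof.
rewrite pair_bigA /= (reindex (uncurry (@mxvec_index m n))) /=.
  by apply: eq_bigr => -[].
exists (@unpair m n) => [[a b] _|k _] /=; first exact: mxvec_indexK.
by rewrite -[RHS]unpairK; case: (unpair k).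
Qed.

(** Fix the index [k] of the first tensor outside factor [i].  Contracting with the
matrix [x] first gives a vector [y k], along which the second tensor is sliced:
this costs [b i] times the squared norm of [y k].  The sum of these over [k] is the
total energy of the slices of the first tensor along the columns of [x]. *)
Lemma balanced_kron n p (a b : 'I_d -> R) (v : multi_index n -> C) (w : multi_index p -> C) :
  (forall i, 0 <= b i) ->
  balanced a v -> balanced b w -> balanced (fun i => a i * b i) (kron v w).
Proof.
move=> b0 av bw i x; rewrite /slice_energy sum_pair_idx.
pose y k : 'rV[C]_(p i) := \row_b \sum_a x 0 (mxvec_index a b) * v (subst_idx k a).
pose xb b' : 'rV[C]_(n i) := \row_a x 0 (mxvec_index a b').
have E k l : \sum_c x 0 c * kron v w (subst_idx (pair_idx (k, l)) c) =
    \sum_b y k 0 b * w (subst_idx l b).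
  rewrite sum_mxvec exchange_big /=; apply: eq_bigr => b' _.
  rewrite mxE mulr_suml; apply: eq_bigr => a' _.
  by rewrite subst_idx_pair /kron fst_pair_idx snd_pair_idx mulrA.
under eq_bigr do under eq_bigr do rewrite E.
have nb0 : 0 <= (p i)%:R * b i * nrm w by rewrite !mulr_ge0 ?nrm_ge0.
apply: (@le_trans _ _ (\sum_k (p i)%:R * b i * nrm w * fnorm (y k))).
  apply: ler_sum => k _; rewrite mulrAC; exact: bw.
rewrite -mulr_sumr.
have -> : \sum_k fnorm (y k) = \sum_b slice_energy (xb b) v.
  rewrite /slice_energy [RHS]exchange_big /=; apply: eq_bigr => k _; rewrite /fnorm big_ord1.
  apply: eq_bigr => b' _; rewrite mxE; congr nsq.
  by apply: eq_bigr => a' _; rewrite mxE.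
have -> : fnorm x = \sum_b fnorm (xb b).
  rewrite /fnorm big_ord1 sum_mxvec exchange_big /=; apply: eq_bigr => b' _.
  by rewrite big_ord1; apply: eq_bigr => a' _; rewrite mxE.
have -> : ((n i * p i)%N%:R * (a i * b i) * (\sum_b fnorm (xb b)) * nrm (kron v w)) =
   (p i)%:R * b i * nrm w * (\sum_b (n i)%:R * a i * fnorm (xb b) * nrm v).
  rewrite -mulr_suml -mulr_sumr nrm_kron natrM; ring.
by rewrite ler_wpM2l // ler_sum.
Qed.

End Kronecker.

Section TensMx.
Variable A : comNzRingType.

Definition tensmx m1 n1 m2 n2 (g : 'M[A]_(m1, n1)) (h : 'M[A]_(m2, n2)) :
    'M[A]_(m1 * m2, n1 * n2) :=
  \matrix_(x, y) (g (unpair x).1 (unpair y).1 * h (unpair x).2 (unpair y).2).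

Lemma tensmxM m1 n1 p1 m2 n2 p2 (g : 'M[A]_(m1, n1)) (g' : 'M[A]_(n1, p1))
    (h : 'M[A]_(m2, n2)) (h' : 'M[A]_(n2, p2)) :
  tensmx g h *m tensmx g' h' = tensmx (g *m g') (h *m h').
Proof.
apply/matrixP => x y; rewrite !mxE sum_mxvec mulr_suml; apply: eq_bigr => a _.
rewrite mulr_sumr; apply: eq_bigr => b _.
by rewrite !mxE mxvec_indexK mulrACA.
Qed.

Lemma tensmx1 m n : tensmx (1%:M : 'M[A]_m) (1%:M : 'M[A]_n) = 1%:M.
Proof.
apply/matrixP => x y; rewrite !mxE -natrM mulnb; congr (_%:R); congr nat_of_bool.
apply/idP/eqP => [|->]; last by rewrite !eqxx.
by rewrite -xpair_eqE -!surjective_pairing => /eqP E; rewrite -[x]unpairK E unpairK.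
Qed.

End TensMx.

Section Product.
Variable R : realType.
Local Notation C := R[i].
Variable d : nat.
Implicit Types n p : 'I_d -> nat.

Lemma kron_act n p (g : forall i, 'M[C]_(n i)) (h : forall i, 'M[C]_(p i)) v w :
  kron (act g v) (act h w) = act (fun i => tensmx (g i) (h i)) (kron v w).
Proof.
apply/funext => k; rewrite /kron /act mulr_suml [RHS]sum_pair_idx; apply: eq_bigr => l _.
rewrite mulr_sumr; apply: eq_bigr => l' _.
rewrite fst_pair_idx snd_pair_idx mulrACA -big_split /=; congr (_ * _).
by apply: eq_bigr => i _; rewrite mxE !ffunE mxvec_indexK.
Qed.

Lemma one_param_bound_act n (r : R) (alpha : 'I_d -> R) (v : multi_index n -> C)
    (g : forall i, 'M[C]_(n i)) :
  (forall i, g i \in unitmx) -> one_param_bound r alpha v -> one_param_bound r alpha (act g v).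
Proof.
move=> gu cv b lam m bu m0 H; apply: (cv (fun i => b i *m g i)) => // [i|k].
  by rewrite unitmx_mul bu gu.
by rewrite -act_comp; exact: H.
Qed.

Lemma fnorm_diag_le1 (m : nat) (c : 'I_m -> R) (M : 'M[C]_m) :
  (forall j, 0 <= c j <= 1) ->
  fnorm (diag_mx (\row_j (c j)%:C) *m M) <= fnorm M.
Proof.
move=> c1; apply: ler_sum => i _; apply: ler_sum => j _.
rewrite mul_diag_mx !mxE nsqM nsq_real -[leRHS]mul1r ler_wpM2r ?nsq_ge0 //.
by have /andP[? ?] := c1 i; rewrite expr_le1.
Qed.

(** Evaluate the lower bound of [balanced_capacity] at [diag (q ^ lam) b], scaled into
the unit ball, with [q = expR (- z)].  The support condition gives
[nrm <= E1 * q ^ (2 m)], while the determinants give [E0 * q ^ (2 L)] from below;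
for large [z] this is possible only if [m <= L]. *)
Lemma one_param_bound_of_balanced n (c : 'I_d -> R) (u : multi_index n -> C)
    (A : forall i, 'M[C]_(n i)) :
  (forall i, 0 <= c i) -> (forall i, A i \in unitmx) ->
  0 < nrm (act A u) -> balanced c (act A u) -> one_param_bound 1 c u.
Proof.
move=> c0 Au N0 bal b lam m bu m0 supp; rewrite mul1r.
pose M i : 'M[C]_(n i) := b i *m invmx (A i).
have Mu i : M i \in unitmx by rewrite unitmx_mul bu unitmx_inv Au.
pose kP i := cid2 (fnorm_scale_le1 (M i)).
pose kap i : R := s2val (kP i).
have kap0 i : 0 < kap i by rewrite /kap; case: (kP i).
have kap1 i : fnorm ((kap i)%:C *: M i) <= 1 by rewrite /kap; case: (kP i).
have KC0 i : (kap i)%:C != 0 :> C.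
  by rewrite -(rmorph0 (real_complex R)) (inj_eq (@complexI R)) gt_eqF.
pose Mk i : 'M[C]_(n i) := (kap i)%:C *: M i.
have Mku i : Mk i \in unitmx by rewrite unitmxZ ?unitfE.
pose L := \sum_i c i * (\sum_j lam i j)%:R.
pose E0 := nrm (act A u) * \prod_i powR (nsq (\det (Mk i))) (c i).
have E00 : 0 < E0.
  rewrite mulr_gt0 // prodr_gt0 // => i _.
  by rewrite powR_gt0 // nsq_gt0 -unitfE -unitmxE.
pose E1 := nrm (act Mk (act A u)).
have E10 : 0 <= E1 by exact: nrm_ge0.
have bAu : act Mk (act A u) = fun k => (\prod_i (kap i)%:C) * act b u k.
  rewrite act_comp -(actZ b); apply: eq_act => i.
  by rewrite /Mk /M -scalemxAl -mulmxA mulVmx ?mulmx1.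
have key z : 0 <= z -> E0 * expR (- (2 * z * L)) <= E1 * expR (- (2 * z * m%:R)).
  move=> z0; pose q i (j : 'I_(n i)) := expR (- (z * (lam i j)%:R)).
  have q01 i j : 0 <= q i j <= 1.
    by rewrite expR_ge0 /= expR_le1 oppr_le0 mulr_ge0.
  pose D i : 'M[C]_(n i) := diag_mx (\row_j (q i j)%:C).
  have Ddet i : nsq (\det (D i)) = expR (- (2 * z * (\sum_j lam i j)%:R)).
    rewrite det_diag; under eq_bigr do rewrite mxE.
    rewrite -rmorph_prod nsq_real -expR_sum -expRM_natr; congr expR.
    by rewrite sumrN natr_sum -mulr_sumr; ring.
  have Du i : D i \in unitmx by rewrite unitmxE unitfE -nsq_gt0 Ddet expR_gt0.
  have DMu i : D i *m Mk i \in unitmx by rewrite unitmx_mul Du Mku.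
  have DM1 i : fnorm (D i *m Mk i) <= 1.
    exact: le_trans (fnorm_diag_le1 _ (q01 i)) (kap1 i).
  have := balanced_capacity bal DMu DM1.
  have -> : nrm (act A u) * \prod_i powR (nsq (\det (D i *m Mk i))) (c i) =
      E0 * expR (- (2 * z * L)).
    rewrite /E0 -mulrA; congr (_ * _).
    have -> : expR (- (2 * z * L)) = \prod_i powR (nsq (\det (D i))) (c i).
      rewrite /L mulr_sumr -sumrN expR_sum; apply: eq_bigr => i _.
      by rewrite Ddet -expRM; congr expR; ring.
    rewrite -big_split /=; apply: eq_bigr => i _.
    by rewrite det_mulmx nsqM (powRM _ (nsq_ge0 _) (nsq_ge0 _)) [RHS]mulrC.
  move=> /le_trans; apply.
  rewrite -act_comp mulr_suml; apply: ler_sum => k _.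
  rewrite act_diag nsqM mulrC.
  have [->|ck] := eqVneq (act Mk (act A u) k) 0; first by rewrite nsq0 !mul0r.
  have bk : act b u k != 0.
    by apply: contraNneq ck => bk; rewrite bAu bk mulr0.
  rewrite ler_wpM2l ?nsq_ge0 //; under eq_bigr do rewrite mxE.
  rewrite -rmorph_prod nsq_real -expR_sum -expRM_natr ler_expR.
  rewrite sumrN -mulr_sumr -natr_sum.
  have := supp k bk; rewrite -(ler_nat R) => mk.
  rewrite mulNr lerN2 [leRHS]mulrC mulrA ler_wpM2l // mulr_ge0 //.
rewrite leNgt; apply/negP => Lm; rewrite -/L in Lm.
have e0 : 0 < m%:R - L by rewrite subr_gt0.
have z0 : 0 <= E1 / E0 / (2 * (m%:R - L)).
  by apply: divr_ge0; [apply: divr_ge0 => //; exact: ltW|apply: mulr_ge0 => //; exact: ltW].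
have {}key := key _ z0.
(* This [z] makes [expR (2 z (m - L))] equal to [expR (E1 / E0) > E1 / E0]. *)
set z := E1 / E0 / _ in key.
have zE : 2 * z * (m%:R - L) = E1 / E0.
  by rewrite /z; field; rewrite ?gt_eqF //= gt_eqF.
have : E0 * expR (E1 / E0) <= E1.
  have -> : E1 / E0 = - (2 * z * L) + 2 * z * m%:R by rewrite -zE; ring.
  by rewrite expRD mulrA -ler_pdivlMr ?expR_gt0 // -expRN.
have : E1 < E0 * expR (E1 / E0).
  apply: (@lt_le_trans _ _ (E0 * (1 + E1 / E0))); last by rewrite ler_wpM2l ?expR_ge1Dx ?ltW.
  by rewrite mulrDr mulr1 mulrCA mulfV ?gt_eqF // mulr1 ltrDr.
by rewrite ltNge => /negP.
Qed.

(** Both tensors are balanced up to an error [tau], hence so is their Kronecker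
product; the resulting bound is polynomial in [tau], and [tau] tends to 0. *)
Lemma one_param_bound_kron n p (r s : R) (alpha beta : 'I_d -> R)
    (v : multi_index n -> C) (w : multi_index p -> C) :
  0 < r -> 0 < s -> (forall i, 0 <= alpha i) -> (forall i, 0 <= beta i) ->
  one_param_bound r alpha v -> one_param_bound s beta w ->
  one_param_bound (r * s) (fun i => alpha i * beta i) (kron v w).
Proof.
move=> r0 s0 a0 b0 cv cw b lam m bu m0 supp.
have [dv dv0 Hv] := capacity_gt0 r0 a0 cv.
have [dw dw0 Hw] := capacity_gt0 s0 b0 cw.
pose a' i := alpha i / r; pose b' i := beta i / s.
have a'0 i : 0 <= a' i by rewrite divr_ge0 // ltW.
have b'0 i : 0 <= b' i by rewrite divr_ge0 // ltW.
pose K i := (1 + a' i) * b' i + a' i * (1 + b' i) + (1 + a' i) * (1 + b' i).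
pose lm i : R := (\sum_j lam i j)%:R.
have main tau : 0 < tau -> tau < 1 ->
    m%:R <= \sum_i a' i * b' i * lm i + tau * \sum_i K i * lm i.
  move=> t0 t1.
  have [g [gu gN gb]] := exists_balanced a'0 dv0 t0 t1 Hv.
  have [h [hu hN hb]] := exists_balanced b'0 dw0 t0 t1 Hw.
  pose at' i := a' i + tau * (1 + a' i); pose bt' i := b' i + tau * (1 + b' i).
  have at0 i : 0 <= at' i by rewrite addr_ge0 // mulr_ge0 ?addr_ge0 // ltW.
  have bt0 i : 0 <= bt' i by rewrite addr_ge0 // mulr_ge0 ?addr_ge0 // ltW.
  have := balanced_kron bt0 gb hb; rewrite kron_act => bal.
  have gh0 : 0 < nrm (act (fun i => tensmx (g i) (h i)) (kron v w)).
    by rewrite -kron_act nrm_kron mulr_gt0.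
  have ghu i : tensmx (g i) (h i) \in unitmx.
    have E : tensmx (g i) (h i) *m tensmx (invmx (g i)) (invmx (h i)) = 1%:M.
      by rewrite tensmxM !mulmxV // tensmx1.
    by have [] := mulmx1_unit E.
  have ab0 i : 0 <= at' i * bt' i by rewrite mulr_ge0.
  have := one_param_bound_of_balanced ab0 ghu gh0 bal bu m0 supp.
  rewrite mul1r => /le_trans; apply; rewrite mulr_sumr -big_split /=.
  apply: ler_sum => i _; rewrite [tau * _]mulrA -mulrDl ler_wpM2r //.
  rewrite -subr_ge0 (_ : _ - _ = tau * (1 - tau) * ((1 + a' i) * (1 + b' i))).
    by apply: mulr_ge0; apply: mulr_ge0; rewrite ?subr_ge0 ?(ltW t1) ?(ltW t0) ?addr_ge0.
  by rewrite /at' /bt' /K; move: (a' i) (b' i) => x y; ring.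
have lim : m%:R <= \sum_i a' i * b' i * lm i.
  have K0 : 0 <= \sum_i K i * lm i.
    by rewrite sumr_ge0 // => i _; rewrite mulr_ge0 // !addr_ge0 // mulr_ge0 ?addr_ge0.
  rewrite leNgt; apply/negP; rewrite -subr_gt0; set S := \sum_i K i * lm i in main K0 *.
  set L := \sum_i _ in main * => Lm.
  (* If [m] exceeded the limit [L] by [e], then [tau * S < e] for this [tau]. *)
  pose e := m%:R - L; pose tau := e / (e + S + e).
  have e0 : 0 < e by [].
  have t0 : 0 < tau by rewrite divr_gt0 // ltr_wpDl // addr_ge0 // ltW.
  have t1 : tau < 1 by rewrite ltr_pdivrMr; lra.
  have := main tau t0 t1; apply/negP; rewrite -ltNge -ltrBrDl -/e.
  rewrite /tau mulrAC ltr_pdivrMr; last lra.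
  by rewrite ltr_pM2l //; lra.
rewrite (_ : \sum_i _ = r * s * \sum_i a' i * b' i * lm i).
  by rewrite ler_wpM2l // mulr_ge0 // ltW.
rewrite mulr_sumr; apply: eq_bigr => i _; rewrite /a' /b' /lm.
by field; rewrite !gt_eqF.
Qed.

(** The dimensions [N i] and [n i * p i] are only propositionally equal, whence the
one-sided inverse [S] between matrices of different shapes. *)
Lemma one_param_bound_recoord n p N (r : R) (alpha : 'I_d -> R)
    (v : multi_index (fun i => (n i * p i)%N) -> C)
    (T : forall i, 'M[C]_(N i, n i * p i)) (S : forall i, 'M[C]_(n i * p i, N i)) :
  N = (fun i => (n i * p i)%N) -> (forall i, S i *m T i = 1%:M) ->
  one_param_bound r alpha v -> one_param_bound r alpha (act T v).
Proof.
move=> NE; subst N => ST; apply: one_param_bound_act => i.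
by have [] := mulmx1_unit (ST i).
Qed.

End Product.

(** * Power series and Smith normal form *)

Lemma ulsubmx11 (A : pzRingType) n (M : 'M[A]_(1 + n)) : ulsubmx M = (M 0 0)%:M.
Proof.
apply/matrixP => a b; rewrite !ord1 !mxE /= mulr1n.
by congr (M _ _); apply/val_inj.
Qed.

Section PowerSeries.
Variable K : fieldType.
Local Notation S := (fps K).
Local Notation t := (fps_t K).
Implicit Types f g : S.

Lemma fps_coefM f g n : (f * g) n = \sum_(i < n.+1) f i * g (n - i)%N.
Proof. by []. Qed.

Lemma fps_coefD f g n : (f + g) n = f n + g n.
Proof. by []. Qed.

Lemma fps_coefN f n : (- f) n = - f n.
Proof. by []. Qed.

Lemma fps_coef0 n : (0 : S) n = 0.
Proof. by []. Qed.

Lemma fps_coef1 n : (1 : S) n = (n == 0%N)%:R.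
Proof. by []. Qed.

(** Reduction modulo [t]. *)
Definition fps_ev0 (f : S) : K := f 0%N.

Fact fps_ev0_zmod : zmod_morphism fps_ev0.
Proof. by []. Qed.
Fact fps_ev0_monoid : monoid_morphism fps_ev0.
Proof.
split => [//|f g].
by rewrite /fps_ev0 fps_coefM big_ord1.
Qed.
HB.instance Definition _ := GRing.isZmodMorphism.Build S K fps_ev0 fps_ev0_zmod.
HB.instance Definition _ := GRing.isMonoidMorphism.Build S K fps_ev0 fps_ev0_monoid.

Fact fps_const_zmod : zmod_morphism (@fps_const K : K -> S).
Proof.
move=> a b; apply/funext => n; rewrite fps_coefD fps_coefN /fps_const.
by case: ifP; rewrite ?subrr.
Qed.
Fact fps_const_monoid : monoid_morphism (@fps_const K : K -> S).
Proof.
split => [|a b]; apply/funext => n; first by rewrite fps_coef1 /fps_const; case: ifP.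
rewrite fps_coefM /fps_const big_ord_recl subn0 /= big1 ?addr0 => [|i _].
  by case: ifP; rewrite ?mulr0.
by rewrite mul0r.
Qed.
HB.instance Definition _ :=
  GRing.isZmodMorphism.Build K S (@fps_const K) fps_const_zmod.
HB.instance Definition _ :=
  GRing.isMonoidMorphism.Build K S (@fps_const K) fps_const_monoid.

Lemma fps_constK c : fps_ev0 (fps_const c) = c.
Proof. by []. Qed.

Lemma fps_coef_tM f n : (t * f) n = if n is m.+1 then f m else 0.
Proof.
rewrite fps_coefM; case: n => [|n]; first by rewrite big_ord1 /fps_t mul0r.
rewrite big_ord_recl /= {1}/fps_t mul0r add0r big_ord_recl /= subn1 /= {1}/fps_t mul1r.
by rewrite big1 ?addr0 // => i _; rewrite {1}/fps_t mul0r.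
Qed.

Lemma fps_coef_tXM m f n : (t ^+ m * f) n = if (n < m)%N then 0 else f (n - m)%N.
Proof.
elim: m n => [|m IH] n; first by rewrite mul1r subn0.
by rewrite exprS -mulrA fps_coef_tM; case: n => [//|n]; rewrite IH ltnS subSS.
Qed.

Lemma fps_t_neq0 : t != 0.
Proof.
by apply/eqP => /(congr1 (@^~ 1%N)) /eqP; rewrite fps_coef0 /fps_t /= oner_eq0.
Qed.

Lemma fps_divXt m f : (forall n, (n < m)%N -> f n = 0) -> exists g, f = t ^+ m * g.
Proof.
move=> f0; exists (fun n => f (n + m)%N); apply/funext => n.
rewrite fps_coef_tXM; case: ltnP => [/f0 //|mn].
by rewrite subnK.
Qed.

(** After scaling, [f = 1 - t x], whose inverse is the geometric series. *)
Lemma fps_unit_const f : f 0%N != 0 -> f \is a GRing.unit.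
Proof.
move=> f0; set c := f 0%N in f0.
have [x fx] : exists x, f = fps_const c * (1 - t * x).
  have [x xP] : exists x, 1 - fps_const c^-1 * f = t * x.
    have [|x xP] := @fps_divXt 1 (1 - fps_const c^-1 * f); last by exists x.
    by case=> // _; rewrite -/(fps_ev0 _) rmorphB rmorphM rmorph1 /= fps_constK mulVf ?subrr.
  by exists x; rewrite -xP subKr mulrA -rmorphM mulfV // rmorph1 mul1r.
pose y := t * x; pose g : S := fun n => (\sum_(i < n.+1) y ^+ i) n.
have ypow i n : (n < i)%N -> (y ^+ i) n = 0.
  by move=> ni; rewrite exprMn fps_coef_tXM ni.
have coef_sum (I : finType) (F : I -> S) n : (\sum_i F i) n = \sum_i F i n.
  by apply: (big_morph (fun f : S => f n)).
have gE N n : (n <= N)%N -> g n = (\sum_(i < N.+1) y ^+ i) n.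
  elim: N => [|N IH]; first by rewrite leqn0 => /eqP ->.
  rewrite leq_eqVlt => /orP[/eqP -> //|nN].
  have -> : \sum_(i < N.+2) y ^+ i = \sum_(i < N.+1) y ^+ i + y ^+ N.+1.
    by rewrite big_ord_recr.
  by rewrite fps_coefD ypow // addr0 IH.
have yg : (1 - y) * g = 1.
  apply/funext => n.
  transitivity (((1 - y) * \sum_(i < n.+1) y ^+ i) n).
    rewrite !fps_coefM; apply: eq_bigr => i _; congr (_ * _).
    by apply: gE; rewrite leq_subr.
  have -> : (1 - y) * \sum_(i < n.+1) y ^+ i = 1 - y ^+ n.+1.
    by rewrite -[RHS]opprB subrX1 -[1 - y]opprB mulNr.
  by rewrite fps_coefD fps_coefN ypow // subr0.
apply/unitrPr; exists (fps_const c^-1 * g).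
by rewrite fx mulrACA -rmorphM mulfV // rmorph1 mul1r yg.
Qed.

(** Power series form a discrete valuation ring: an entry of least order divides all
others, so it can be moved to the corner and used to clear its row and column. *)
Lemma fps_smith n (h : 'M[S]_n) : \det h != 0 ->
  exists (a b : 'M[S]_n) (l : 'I_n -> nat),
    [/\ a \in unitmx, b \in unitmx & h = a *m diag_mx (\row_j t ^+ l j) *m b].
Proof.
elim: n h => [|n IH] h dh.
  by exists 1%:M, 1%:M, (fun=> 0%N); rewrite !unitmx1 [h]flatmx0 [RHS]flatmx0.
have ex : exists e, [exists i, exists j, h i j e != 0].
  apply: contrapT => /forallNP H; case/eqP: dh.
  have -> : h = 0.
    apply/matrixP => i j; rewrite mxE; apply/funext => e; apply/eqP/negPn/negP => he.
    by apply: (H e); apply/existsP; exists i; apply/existsP; exists j.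
  by rewrite det0.
have [e /existsP[i /existsP[j hij]] emin] := ex_minnP ex.
have [h' hE] : exists h' : 'M[S]_n.+1, h = t ^+ e *: h'.
  have E i' j' : exists g, h i' j' = t ^+ e * g.
    apply: fps_divXt => m me; apply/eqP/negPn/negP => hm.
    have := emin m; rewrite leqNgt me => /(_ _)/negP; case => //.
    by apply/existsP; exists i'; apply/existsP; exists j'.
  exists (\matrix_(i', j') sval (cid (E i' j'))).
  by apply/matrixP => i' j'; rewrite !mxE; exact: svalP (cid (E i' j')).
have pu : h' i j \is a GRing.unit.
  apply: fps_unit_const; apply: contraNneq hij => h0.
  by rewrite hE mxE fps_coef_tXM ltnn subnn h0.
pose P := tperm_mx i ord0 : 'M[S]_n.+1; pose Q := tperm_mx ord0 j : 'M[S]_n.+1.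
have PP : P *m P = 1%:M by rewrite -perm_mxM tperm2 perm_mx1.
have QQ : Q *m Q = 1%:M by rewrite -perm_mxM tperm2 perm_mx1.
have Pu : P \in unitmx by rewrite unitmx_perm.
have Qu : Q \in unitmx by rewrite unitmx_perm.
pose h1 : 'M[S]_(1 + n) := P *m h' *m Q.
have h100 : h1 0 0 = h' i j.
  by rewrite /h1 -xrowE -xcolE !mxE !tpermL tpermR.
pose p := h1 0 0.
have pu1 : p \is a GRing.unit by rewrite /p h100.
pose r := ursubmx h1; pose c := dlsubmx h1; pose D := drsubmx h1.
have h1E : h1 = block_mx p%:M r c D.
  by rewrite -[LHS]submxK ulsubmx11.
pose a1 : 'M[S]_(1 + n) := block_mx 1%:M 0 (p^-1 *: c) 1%:M.
pose b1 : 'M[S]_(1 + n) := block_mx 1%:M (p^-1 *: r) 0 1%:M.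
(* The Schur complement of the pivot. *)
pose D1 := D - p^-1 *: (c *m r).
have h1F : h1 = a1 *m block_mx p%:M 0 0 D1 *m b1.
  rewrite h1E /a1 /b1 !mulmx_block !mul1mx !mulmx1 !mul0mx !mulmx0 !addr0 !add0r.
  rewrite !mul_scalar_mx !mul_mx_scalar !scalerA divrr // !scale1r -scalemxAr /D1.
  by rewrite addrC subrK.
have au1 : a1 \in unitmx by rewrite unitmxE det_lblock !det1 mulr1 unitr1.
have bu1 : b1 \in unitmx by rewrite unitmxE det_ublock !det1 mulr1 unitr1.
have hF : h = P *m a1 *m block_mx (t ^+ e * p)%:M 0 0 (t ^+ e *: D1) *m b1 *m Q.
  have -> : block_mx (t ^+ e * p)%:M 0 0 (t ^+ e *: D1) =
      t ^+ e *: block_mx p%:M 0 0 D1 :> 'M[S]_(1 + n).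
    by rewrite scale_block_mx !scaler0 scale_scalar_mx.
  rewrite -!scalemxAr -!scalemxAl hE; congr (_ *: _).
  rewrite -[P *m a1 *m _]mulmxA -[P *m _ *m b1]mulmxA -h1F /h1 !mulmxA PP mul1mx.
  by rewrite -mulmxA QQ mulmx1.
have [|a2 [b2 [l [a2u b2u D2E]]]] := IH (t ^+ e *: D1).
  apply: contraNneq dh => d0.
  have dB : \det (block_mx (t ^+ e * p)%:M 0 0 (t ^+ e *: D1) : 'M_(1 + n)) = 0.
    by rewrite det_lblock d0 mulr0.
  by rewrite hF !det_mulmx dB !(mulr0, mul0r).
exists (P *m a1 *m block_mx p%:M 0 0 a2), (block_mx 1%:M 0 0 b2 *m b1 *m Q).
exists (fun k : 'I_(1 + n) => match fintype.split k with inl _ => e | inr k' => l k' end).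
split.
- by rewrite !unitmx_mul Pu au1 unitmxE (@det_lblock _ 1 n) det_scalar1 unitrM pu1 -unitmxE.
- by rewrite !unitmx_mul Qu bu1 unitmxE (@det_lblock _ 1 n) det1 mul1r -unitmxE b2u.
have -> : diag_mx (\row_k t ^+ match fintype.split k with inl _ => e | inr k' => l k' end) =
    block_mx (t ^+ e)%:M 0 0 (diag_mx (\row_j t ^+ l j)) :> 'M[S]_(1 + n).
  rewrite -diag_const_mx -diag_mx_row; congr diag_mx.
  apply/rowP => k; rewrite !mxE; by case: (fintype.split k) => k'; rewrite !mxE.
have BE : block_mx (t ^+ e * p)%:M 0 0 (t ^+ e *: D1) =
    (block_mx p%:M 0 0 a2 *m block_mx (t ^+ e)%:M 0 0 (diag_mx (\row_j t ^+ l j))) *m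
    block_mx 1%:M 0 0 b2 :> 'M[S]_(1 + n).
  rewrite !mulmx_block !mulmx1 !mul0mx !mulmx0 !addr0 !add0r !mul0mx -D2E.
  by rewrite -scalar_mxM mulrC.
have assoc (x1 x2 x3 x4 x5 x6 x7 : 'M[S]_n.+1) :
    x1 *m x2 *m (x3 *m x4 *m x5) *m x6 *m x7 =
    x1 *m x2 *m x3 *m x4 *m (x5 *m x6 *m x7) by rewrite !mulmxA.
by rewrite hF BE; exact: assoc.
Qed.

End PowerSeries.

(** * G-stable rank through one-parameter subgroups *)

Section Valuation.
Variables (K : fieldType) (R : realType).
Local Notation S := (fps K).
Local Notation t := (fps_t K).

Lemma le_valt I (v : I -> laurent K) (m : nat) (f : I -> S) :
  (forall i, v i = (t ^+ m * f i)%:F) -> (m%:R%:E <= valt R v)%E.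
Proof.
move=> vf; apply: ereal_sup_ubound => /=.
by exists m%:Z => //; exists f => i; rewrite vf rmorphM rmorphXn.
Qed.

(** Only positive exponents matter, because the bound is nonnegative. *)
Lemma valt_le I (v : I -> laurent K) (x : R) : 0 <= x ->
  (forall (m : nat) f, (0 < m)%N -> (forall i, v i = (t ^+ m * f i)%:F) -> m%:R <= x) ->
  (valt R v <= x%:E)%E.
Proof.
move=> x0 H; apply: ge_ereal_sup => _ /= [m [f vf] <-]; rewrite lee_fin.
have [m0|] := ltP 0 m; last by move=> m0; rewrite (le_trans _ x0) // lerz0.
case: m m0 vf => // m m0 vf; apply: (H m f) => // i.
by rewrite vf rmorphM rmorphXn.
Qed.

Variables (d : nat) (U : 'I_d -> vectType K).
Implicit Type h : forall i, 'M[S]_(\dim {:U i}).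

Lemma tact_tofrac h (u : tensor U) k :
  tact (fun i => map_mx (@FracField.tofrac S) (h i)) (tconst u) k =
  (act h (fun l => fps_const (u l)) k)%:F.
Proof.
rewrite ffunE map_act /act; apply: eq_bigr => l _.
by rewrite ffunE.
Qed.

Lemma act_fps_const (b : forall i, 'M[K]_(\dim {:U i})) (u : tensor U) k :
  act (fun i => map_mx (@fps_const K) (b i)) (fun l => fps_const (u l)) k =
  fps_const (act b u k).
Proof. by rewrite map_act. Qed.

Lemma act_tX (lam : forall i, 'I_(\dim {:U i}) -> nat) u k :
  act (fun i => diag_mx (\row_j t ^+ lam i j)) u k =
  t ^+ (\sum_i lam i (k i)) * u k.
Proof.
rewrite act_diag; congr (_ * _); rewrite -prodrXr.
by apply: eq_bigr => i _; rewrite mxE.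
Qed.

Lemma det_tX n (l : 'I_n -> nat) : \det (diag_mx (\row_j t ^+ l j)) = t ^+ (\sum_j l j).
Proof.
by rewrite det_diag -prodrXr; apply: eq_bigr => j _; rewrite mxE.
Qed.

End Valuation.

Section RankCrit.
Variables (C : fieldType) (R : realType) (d : nat) (U : 'I_d -> vectType C).
Local Notation t := (fps_t C).

(** Test the infimum on [diag (t ^ lam) * b]. *)
Lemma one_param_bound_of_rank (alpha : 'I_d -> R) (u : tensor U) (r : R) :
  (forall i, 0 <= alpha i) -> (r%:E <= gstable_rank alpha u)%E ->
  one_param_bound r alpha (u : multi_index (fun i => \dim {:U i}) -> C).
Proof.
move=> a0 ru b lam m bu m0 supp.
pose H i := diag_mx (\row_j t ^+ lam i j) *m map_mx (@fps_const C) (b i).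
pose g i := map_mx (@FracField.tofrac (fps C)) (H i).
have dH i : \det (H i) = t ^+ (\sum_j lam i j) * fps_const (\det (b i)).
  by rewrite det_mulmx det_tX det_map_mx.
have db i : \det (b i) != 0 by rewrite -unitfE -unitmxE.
have gG i : GLt (g i).
  split; first by exists (H i).
  rewrite unitmxE unitfE det_map_mx tofrac_eq0 dH mulf_neq0 //.
    by rewrite expf_neq0 // fps_t_neq0.
  by apply: contraNneq (db i) => /(congr1 (@fps_ev0 C)); rewrite fps_constK => ->.
have gu k : tact g (tconst u) k =
    (t ^+ (\sum_i lam i (k i)) * fps_const (act b u k))%:F.
  by rewrite tact_tofrac -act_comp act_tX act_fps_const.
have val_ge : (m%:R%:E <= valt R (tact g (tconst u)))%E.
  have := @le_valt C R _ (tact g (tconst u)) m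
    (fun k => t ^+ (\sum_i lam i (k i) - m) * fps_const (act b u k)).
  apply=> k.
  rewrite gu; congr (_ %:F); have [->|/supp mk] := eqVneq (act b u k) 0.
    by rewrite rmorph0 !mulr0.
  by rewrite mulrA -exprD subnKC.
have det_le i : (valt R (fun _ : unit => \det (g i)) <= (\sum_j lam i j)%:R%:E)%E.
  apply: valt_le => // p f p0 /(_ tt); rewrite det_map_mx dH => /eqP.
  rewrite tofrac_eq => /eqP E; rewrite ler_nat leqNgt; apply/negP => lp.
  have /eqP := congr1 (fun f : fps C => f (\sum_j lam i j)%N) E.
  by rewrite !fps_coef_tXM ltnn subnn lp (negbTE (db i)).
have mpos : (0 < m%:R :> R) by rewrite ltr0n.
have vpos : (0 < valt R (tact g (tconst u)))%E.
  by apply: lt_le_trans val_ge; rewrite lte_fin.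
have : (gstable_rank alpha u <= mu alpha g u)%E.
  by apply: ereal_inf_lbound; exists g.
move/(le_trans ru) => rmu.
pose Y := \sum_i alpha i * (\sum_j lam i j)%:R.
have Y0 : 0 <= Y by rewrite sumr_ge0 // => i _; rewrite mulr_ge0.
have : (r%:E <= Y%:E * (m%:R^-1)%:E)%E.
  apply: (le_trans rmu); rewrite /mu.
  apply: (@le_trans _ _ (Y%:E * (valt R (tact g (tconst u)))^-1)%E).
    apply: lee_wpmul2r; first by rewrite inve_ge0 ltW.
    rewrite /Y -sumEFin; apply: lee_sum => i _; rewrite EFinM.
    by apply: lee_wpmul2l; rewrite ?lee_fin.
  apply: lee_wpmul2l; first by rewrite lee_fin.
  rewrite (_ : (m%:R^-1)%:E = (m%:R%:E)^-1)%E; last by rewrite inver gt_eqF.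
  by rewrite lee_pV2 // inE ?lee_fin // ltW.
by rewrite -EFinM lee_fin ler_pdivlMr.
Qed.

(** Take Smith forms [g i = a i * diag (t ^ lam i) * b i].  If [t ^+ m] divides
[tact g u], it divides [diag (t ^ lam) b u], since [a] is invertible over the power
series; a coordinate of weight below [m] is then divisible by [t] before scaling,
so it vanishes in [b(0) u].  Hence the bound applies to [b(0)] and limits [m]. *)
Lemma rank_of_one_param_bound (gamma : 'I_d -> R) (u : tensor U) (r : R) :
  0 < r -> (forall i, 0 <= gamma i) ->
  one_param_bound r gamma (u : multi_index (fun i => \dim {:U i}) -> C) ->
  (r%:E <= gstable_rank gamma u)%E.
Proof.
move=> r0 c0 cu; apply: le_ereal_inf_tmp => _ /= [g [gG vpos] <-].
pose h i := sval (cid (gG i).1).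
have gE : g = fun i => map_mx (@FracField.tofrac (fps C)) (h i).
  by apply/functional_extensionality_dep => i; rewrite /h; case: (cid _).
have dh i : \det (h i) != 0.
  by have := (gG i).2; rewrite gE unitmxE unitfE det_map_mx tofrac_eq0.
have sm i := cid (fps_smith (dh i)).
pose a i := sval (sm i).
have sm2 i := cid (svalP (sm i)); pose b i := sval (sm2 i).
have sm3 i := cid (svalP (sm2 i)); pose lam i := sval (sm3 i).
have hE i : [/\ a i \in unitmx, b i \in unitmx &
    h i = a i *m diag_mx (\row_j t ^+ lam i j) *m b i].
  exact: svalP (sm3 i).
pose b0 i := map_mx (@fps_ev0 C) (b i).
have b0u i : b0 i \in unitmx.
  by have [_ bu _] := hE i; rewrite unitmxE det_map_mx rmorph_unit // -unitmxE.
pose cu' l := fps_const (u l).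
have b0E k : act b0 u k = fps_ev0 (act b cu' k).
  by rewrite map_act; congr (act _ _ k).
pose Y := \sum_i gamma i * (\sum_j lam i j)%:R.
have Y0 : 0 <= Y by rewrite sumr_ge0 // => i _; rewrite mulr_ge0.
have val_le : (valt R (tact g (tconst u)) <= (Y / r)%:E)%E.
  apply: valt_le; first by rewrite divr_ge0 // ltW.
  move=> m f m0 E; rewrite ler_pdivlMr // mulrC; apply: (cu b0 lam) => // k.
  rewrite b0E; apply: contraNT; rewrite -ltnNge => lm; apply/eqP.
  have {}E : act h cu' = fun k => t ^+ m * f k.
    apply/funext => l; apply/eqP; rewrite -tofrac_eq -E gE tact_tofrac //.
  have : act (fun i => invmx (a i)) (act h cu') k =
      act (fun i => diag_mx (\row_j t ^+ lam i j)) (act b cu') k.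
    rewrite !act_comp; congr (act _ cu' k); apply/functional_extensionality_dep => i.
    by have [au _ ->] := hE i; rewrite !mulmxA mulVmx // mul1mx.
  rewrite E act_scale act_tX; set F := act _ f k.
  move=> /(congr1 (fun f : fps C => f (\sum_i lam i (k i))%N)).
  by rewrite !fps_coef_tXM lm ltnn subnn.
have det_ge i : ((\sum_j lam i j)%:R%:E <= valt R (fun _ : unit => \det (g i)))%E.
  apply: (@le_valt _ _ _ _ _ (fun _ => \det (a i) * \det (b i))) => _.
  rewrite gE det_map_mx; have [_ _ ->] := hE i.
  by rewrite !det_mulmx det_tX mulrAC mulrC.
have YX : (Y%:E <= \sum_i (gamma i)%:E * valt R (fun _ : unit => \det (g i)))%E.
  rewrite /Y -sumEFin; apply: lee_sum => i _; rewrite EFinM.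
  by apply: lee_wpmul2l; rewrite ?lee_fin.
rewrite /mu.
case: (valt R (tact g (tconst u))) vpos val_le => [z||] //.
rewrite lte_fin lee_fin => z0 zY.
apply: (@le_trans _ _ (Y%:E * (z%:E)^-1)%E); last first.
  by apply: lee_wpmul2r YX; rewrite inve_ge0 lee_fin ltW.
rewrite inver gt_eqF // -EFinM lee_fin ler_pdivlMr // mulrC.
by rewrite -ler_pdivlMr.
Qed.

End RankCrit.

(** * The vertical product *)

Section Vertical.
Variables (R : realType) (d : nat) (V W : 'I_d -> vectType R[i]).
Local Notation C := R[i].

(** In the chosen bases the vertical product differs from the Kronecker product by a
change of coordinates in each factor. *)
Lemma one_param_bound_vtens (r : R) (alpha : 'I_d -> R) (v : tensor V) (w : tensor W) :
  one_param_bound r alpha (kron (v : multi_index (fun i => \dim {:V i}) -> C)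
                     (w : multi_index (fun i => \dim {:W i}) -> C)) ->
  one_param_bound r alpha (vtens v w : multi_index (fun i => \dim {:tens2 (V i) (W i)}) -> C).
Proof.
pose T i : 'M[C]_(\dim {:tens2 (V i) (W i)}, \dim {:V i} * \dim {:W i}) :=
  \matrix_(m, x) coord (vbasis {:tens2 (V i) (W i)}) m
    (tpure2 (vbasis {:V i})`_(unpair x).1 (vbasis {:W i})`_(unpair x).2).
pose S i : 'M[C]_(\dim {:V i} * \dim {:W i}, \dim {:tens2 (V i) (W i)}) :=
  \matrix_(x, m) ((vbasis {:tens2 (V i) (W i)})`_m : 'M[C]_(_, _))
     (unpair x).1 (unpair x).2.
have -> : (vtens v w : multi_index (fun i => \dim {:tens2 (V i) (W i)}) -> C) =
   act T (kron (v : multi_index (fun i => \dim {:V i}) -> C)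
               (w : multi_index (fun i => \dim {:W i}) -> C)).
  apply/funext => m; rewrite ffunE /act sum_pair_idx.
  apply: eq_bigr => k _; apply: eq_bigr => l _.
  rewrite /kron fst_pair_idx snd_pair_idx mulrC; congr (_ * _).
  rewrite ffunE; apply: eq_bigr => i _.
  by rewrite mxE ffunE mxvec_indexK.
apply: (@one_param_bound_recoord _ _ _ _ _ _ _ _ T S).
  by apply/funext => i; rewrite dimvf.
move=> i; apply/matrixP => x y; rewrite [LHS]mxE.
pose z := tpure2 (vbasis {:V i})`_(unpair y).1 (vbasis {:W i})`_(unpair y).2.
transitivity (z (unpair x).1 (unpair x).2).
  rewrite [in RHS](coord_vbasis (memvf (z : tens2 (V i) (W i)))) summxE.
  by apply: eq_bigr => m _; rewrite !mxE mulrC.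
have freeb (X : vectType C) : free (vbasis {:X}) by exact/basis_free/vbasisP.
rewrite !mxE !coord_free ?freeb // -natrM mulnb; congr (_%:R); congr nat_of_bool.
apply/idP/eqP => [|->]; last by rewrite !eqxx.
by rewrite -xpair_eqE -!surjective_pairing => /eqP E; rewrite -[x]unpairK -E unpairK.
Qed.

End Vertical.

(** Reduces a product of possibly infinite ranks to real lower bounds, which is how
the one-parameter bounds are expressed. *)
Lemma mule_le_fin (R : realType) (x y z : \bar R) :
  (0 <= x)%E -> (0 <= y)%E -> (0 <= z)%E ->
  (forall r s : R, 0 < r -> 0 < s -> (r%:E <= x)%E -> (s%:E <= y)%E ->
     ((r * s)%:E <= z)%E) ->
  (x * y <= z)%E.
Proof.
move=> x0 y0 z0 H.
have zy : (forall A, 0 < A -> exists r s,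
      [/\ 0 < r, 0 < s, A = r * s, (r%:E <= x)%E & (s%:E <= y)%E]) ->
    z = +oo%E.
  move=> HA; apply/eq_infty => A; have [A0|A0] := ltP 0 A.
    by have [r [s [r0 s0 -> rx sy]]] := HA A A0; exact: H.
  by apply: le_trans z0; rewrite lee_fin.
case: x y x0 y0 H zy => [x||] [y||] //; rewrite ?lee_fin => x0 y0 H zy.
- have [->|xN0] := eqVneq x 0; first by rewrite mul0e.
  have [->|yN0] := eqVneq y 0; first by rewrite mule0.
  by rewrite -EFinM; apply: H; rewrite // lt_def ?xN0 ?yN0.
- have [->|xN0] := eqVneq x 0; first by rewrite mul0e.
  have xp : 0 < x by rewrite lt_def xN0.
  rewrite zy ?leey // => A A0; exists x, (A / x); split => //; last exact: leey.
    by rewrite divr_gt0.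
  by rewrite mulrC divfK.
- have [->|yN0] := eqVneq y 0; first by rewrite mule0.
  have yp : 0 < y by rewrite lt_def yN0.
  rewrite zy ?leey // => A A0; exists (A / y), y; split => //; last exact: leey.
    by rewrite divr_gt0.
  by rewrite divfK.
- by rewrite zy ?leey // => A A0; exists A, 1; rewrite mulr1 !leey ltr01.
Qed.

Lemma gstable_rank_ge0 (K : fieldType) (R : realType) (d : nat) (U : 'I_d -> vectType K)
    (gamma : 'I_d -> R) (u : tensor U) :
  (forall i, 0 <= gamma i) -> (0 <= gstable_rank gamma u)%E.
Proof.
move=> c0; apply: le_ereal_inf_tmp => _ /= [g [gG vpos] <-].
rewrite /mu mule_ge0 ?inve_ge0 ?(ltW vpos) //.
apply: sume_ge0 => i _; rewrite mule_ge0 ?lee_fin //.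
have [h gE] := (gG i).1.
apply: (@le_valt _ R _ _ 0 (fun _ => \det h)) => _.
by rewrite gE det_map_mx mul1r.
Qed.

Theorem theorem5p4 (R : realType) (d : nat)
    (V W : 'I_d -> vectType R[i]) (v : tensor V) (w : tensor W)
    (alpha beta : 'I_d -> R)
    (alpha_gt0 : forall i, 0 < alpha i) (beta_gt0 : forall i, 0 < beta i) :
  (gstable_rank alpha v * gstable_rank beta w
     <= gstable_rank (fun i => (alpha i * beta i)%R) (vtens v w))%E.
Proof.
have a0 i : 0 <= alpha i by exact: ltW.
have b0 i : 0 <= beta i by exact: ltW.
have ab0 i : 0 <= alpha i * beta i by exact: mulr_ge0.
apply: mule_le_fin; try exact: gstable_rank_ge0.
move=> r s r0 s0 rv sw; apply: rank_of_one_param_bound => //; first exact: mulr_gt0.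
apply: one_param_bound_vtens; apply: one_param_bound_kron => //; exact: one_param_bound_of_rank.
Qed.
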